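(* Let $l_1,l_2,n$ be positive integers. Let $\{S_j\}_{j=1}^{l_1}$ be a family of connected non-singular real algebraic hypersurfaces of $\mathbb{R}^n$, where each $S_j$ is the zero set of a real polynomial $f_j$. Let $D\neq\emptyset$ be a connected open subset of $\mathbb{R}^n$ whose closure $\overline{D}$ is compact and connected. Suppose the following. (1) For any sufficiently small open neighborhood $U_D$ of $\overline{D}$, $D=U_D\cap\bigcap_{j=1}^{l_1}\{x\mid f_j(x)>0\}$. (2) For each increasing sequence $\{j_i\}_{i=1}^{l_3}\subset\mathbb{N}_{l_1}$ ($1\le l_3\le l_1$) and each point $p\in\bigcap_{i=1}^{l_3}S_{j_i}\cap\overline{D}$, the dimension of $\bigcap_{i=1}^{l_3}T_pS_{j_i}$ is $n-l_3$. (3) There exists a surjective map $m_{l_1,l_2}:\mathbb{N}_{l_1}\to\mathbb{N}_{l_2}$ such that for any increasing sequence $\{j_i\}_{i=1}^{l_3}\subset\mathbb{N}_{l_1}$ for which $\bigcap_{i=1}^{l_3}S_{j_i}\cap\overline{D}$ is non-empty, the restriction of $m_{l_1,l_2}$ to the set $\{j_i\}_{i=1}^{l_3}$ is injective. Let $m_{l_2}:\mathbb{N}_{l_2}\to\mathbb{N}\sqcup\{0\}$ be a map and let $m:=n+\sum_{j=1}^{l_2}m_{l_2}(j)$. Then there exist an $m$-dimensional non-singular real algebraic closed manifold $M$ and a smooth real algebraic map $f:M\to\mathbb{R}^n$ such that $f(M)=\overline{D}$ and, for each $p\in\overline{D}$, the set $f^{-1}(p)$ is a one-point set or diffeomorphic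 to a finite product of spheres $\prod_{j}S^{k_j}$, and $\dim f^{-1}(p)\le m-n$. If in addition the function $m_{l_2}$ is always positive, then $M$ can be obtained as a connected manifold.
   Context: $\mathbb{N}$ is the set of positive integers and $\mathbb{N}_a:=\{1,\dots,a\}$ for a positive integer $a$. $S^k$ is the unit sphere in $\mathbb{R}^{k+1}$ ($S^0$ is a two-point set). A closed manifold is a compact manifold without boundary. $T_pX$ is the tangent space of $X$ at $p$ (for $X\subset\mathbb{R}^n$, viewed as a subspace of $T_p\mathbb{R}^n$). A real algebraic manifold is a union of connected components of the intersection of the zero sets of finitely many real polynomials in some real affine space $\mathbb{R}^N$. It is non-singular if it is a smooth submanifold by virtue of the implicit function theorem applied to the defining polynomial map; in particular, the zero set $S_j$ of $f_j$ is a non-singular hypersurface if the gradient of $f_j$ is non-zero at each point of $S_j$. A real algebraic map $f:M\to\mathbb{R}^n$ is the composition of the canonical embedding of $M$ into its ambient real affine space $\mathbb{R}^N$ with the canonical projection $\mathbb{R}^N=\mathbb{R}^n\times\mathbb{R}^{N-n}\to\mathbb{R}^n$ to the first factor. *)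

(* Defs.v *)
(* [mpoly] is required but not imported: its notations
   clash with those of MathComp-Analysis. *)
From mathcomp Require Export all_boot all_order all_algebra.
From mathcomp Require Export all_classical all_reals all_analysis.
From mathcomp Require mpoly.
Export Order.TTheory GRing.Theory Num.Theory.
Export numFieldNormedType.Exports.

Set Implicit Arguments.
Unset Strict Implicit.
Unset Printing Implicit Defensive.

Local Open Scope classical_set_scope.
Local Open Scope ring_scope.

Definition peval (R : realType) (n : nat) (f : mpoly.mpoly n R)
    (x : 'rV[R]_n) : R :=
  mpoly.meval (fun i => x 0 i) f.

Definition zero_set (R : realType) (n : nat) (f : mpoly.mpoly n R) :
    set 'rV[R]_n :=
  [set x | peval f x = 0].

Definition gradient (R : realType) (n : nat) (f : mpoly.mpoly n R)
    (x : 'rV[R]_n) : 'rV[R]_n :=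
  \row_i peval (mpoly.mderiv i f) x.

Definition common_zero_set (R : realType) (n c : nat)
    (F : 'I_c -> mpoly.mpoly n R) : set 'rV[R]_n :=
  [set x | forall i, zero_set (F i) x].

Definition jacobian_mx (R : realType) (n c : nat)
    (F : 'I_c -> mpoly.mpoly n R) (x : 'rV[R]_n) : 'M[R]_(c, n) :=
  \matrix_(i < c) gradient (F i) x.

Definition nonsingular_hypersurface (R : realType) (n : nat)
    (f : mpoly.mpoly n R) : Prop :=
  forall x, zero_set f x -> gradient f x != 0.

Definition union_of_components (T : topologicalType) (Z M : set T) : Prop :=
  exists2 I : set T, I `<=` Z & M = \bigcup_(x in I) connected_component Z x.

(* [M] is cut out near each of its points by [c] polynomials whose differentials
   are independent there, so that the implicit function theorem makes it a
   smooth submanifold of dimension [N - c = m]. *)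
Definition nonsingular_algebraic_manifold (R : realType) (N m : nat)
    (M : set 'rV[R]_N) : Prop :=
  exists (c : nat) (F : 'I_c -> mpoly.mpoly N R),
    [/\ (m + c = N)%N,
        union_of_components (common_zero_set F) M &
        forall x, M x -> row_free (jacobian_mx F x)].

(* The ambient space R^(n + k) is read as R^n x R^k. *)
Definition real_algebraic_map (R : realType) (n k : nat)
    (M : set 'rV[R]_(n + k)) (f : 'rV[R]_(n + k) -> 'rV[R]_n) : Prop :=
  forall x, M x -> f x = lsubmx x.

(* Velocities at time 0 of the differentiable curves that run in X. *)
Definition tangent_space (R : realType) (n : nat) (X : set 'rV[R]_n)
    (p : 'rV[R]_n) : set 'rV[R]_n :=
  [set v | exists gamma : R -> 'rV[R]_n,
    [/\ gamma 0 = p,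
        \forall t \near (0 : R), X (gamma t) /\ derivable gamma t 1 &
        'D_1 gamma 0 = v]].

(* Nothing is claimed about a set that is not a vector subspace. *)
Definition has_dim (R : realType) (n : nat) (A : set 'rV[R]_n) (d : nat) :
    Prop :=
  exists2 V : {vspace 'rV[R]_n}, A = [set v | v \in V] & \dim V = d.

(* For U open in a finite-dimensional space, class C^k in the usual sense. *)
Fixpoint class_C (R : realType) (V W : normedModType R) (k : nat) (U : set V)
    (f : V -> W) : Prop :=
  (forall x, U x -> {for x, continuous f}) /\
  (if k is k'.+1 then
     (forall x v, U x -> derivable f x v) /\
     (forall v, class_C k' U (fun x => 'D_v f x))
   else True).

Definition smooth_on (R : realType) (V W : normedModType R) (U : set V)
    (f : V -> W) : Prop :=
  forall k, class_C k U f.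

(* Smoothness on an arbitrary subset: local existence of smooth extensions. *)
Definition smooth_map (R : realType) (a b : nat) (X : set 'rV[R]_a)
    (f : 'rV[R]_a -> 'rV[R]_b) : Prop :=
  forall x, X x -> exists (U : set 'rV[R]_a) (g : 'rV[R]_a -> 'rV[R]_b),
    [/\ open U, U x, smooth_on U g & forall y, X y -> U y -> f y = g y].

Definition diffeomorphic (R : realType) (a b : nat) (X : set 'rV[R]_a)
    (Y : set 'rV[R]_b) : Prop :=
  exists (f : 'rV[R]_a -> 'rV[R]_b) (g : 'rV[R]_b -> 'rV[R]_a),
    [/\ smooth_map X f, smooth_map Y g,
        forall x, X x -> Y (f x) /\ g (f x) = x &
        forall y, Y y -> X (g y) /\ f (g y) = y].

Definition smooth_submanifold (R : realType) (N d : nat) (X : set 'rV[R]_N) :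
    Prop :=
  forall x, X x -> exists (U : set 'rV[R]_N) (V : set 'rV[R]_d),
    [/\ open U, U x, open V & diffeomorphic (X `&` U) V].

Definition unit_sphere (R : realType) (k : nat) : set 'rV[R]_k.+1 :=
  [set x | \sum_i x 0 i ^+ 2 = 1].

(* The product of the spheres S^(k j), in the product of the R^(k j + 1). *)
Definition sphere_product (R : realType) (r : nat) (k : 'I_r -> nat) :
    set 'rV[R]_(\sum_(j < r) (k j).+1)%N :=
  [set x | forall j, @unit_sphere R (k j) (submxrow x j)].

(* Main.v *)
Require Import Defs.
From mathcomp Require Import ring lra zify.
From mathcomp Require Import -(notations) mpoly.

(* Let h be the map of condition (3), P_b the product of the f_j with h j = b,
   and M the set of the (x, y) with x in the closure of D and |y_b|^2 = P_b(x)
   for each b, where y_b ranges over R^(mu b + 1). Over a point x the fibre is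
   the product of the spheres of radius sqrt(P_b(x)), those with P_b(x) = 0
   being points.
   By (3) at most one factor of each P_b vanishes at a point of the closure of
   D, and by (2) the gradients of the vanishing f_j are independent there; this
   makes the Jacobian of the equations of M of full rank. It also yields a
   vector along which all vanishing f_j increase, so that points near the
   closure of D at which every P_b is nonnegative lie in the closure of D; hence
   M is open and closed in the zero set of its equations.
   If all mu b are positive, any point of M is joined inside its fibre, along
   great circles, to the image of the closure of D under a section. *)

Set Implicit Arguments.
Unset Strict Implicit.
Unset Printing Implicit Defensive.

Local Open Scope classical_set_scope.
Local Open Scope ring_scope.

(** * Polynomial functions *)

Lemma cvg_rV (R : realType) (T : Type) (F : set_system T) (n : nat)
    (f : T -> 'rV[R]_n) (l : 'rV[R]_n) : Filter F ->
  (forall i, f x 0 i @[x --> F] --> l 0 i) -> f @ F --> l.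
Proof.
move=> FF fl A [P lP PA].
have : \forall x \near F, forall i, P 0 i (f x 0 i).
  by apply: filter_forall => i; exact: (fl i _ (lP 0 i)).
by apply: filterS => x Px; apply: PA => i j; rewrite ord1.
Qed.

Lemma continuous_rV (R : realType) (T : topologicalType) (n : nat)
    (f : T -> 'rV[R]_n) :
  (forall i, continuous (fun x => f x 0 i)) -> continuous f.
Proof. by move=> cf x; apply: cvg_rV => i; exact: cf. Qed.

Lemma continuous_pair (S T U : topologicalType) (f : S -> T) (g : S -> U) :
  continuous f -> continuous g -> continuous (fun x => (f x, g x)).
Proof. by move=> cf cg x; exact: (cvg_pair (cf x) (cg x)). Qed.

(** Constants and variables generate the polynomials as an algebra, each monomial being a product of
    powers of variables. This reduces each later fact about all polynomials to its behaviour under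
    sums and products. *)
Lemma mpoly_alg_ind (R : realType) (n : nat) (P : mpoly.mpoly n R -> Prop) :
    (forall c, P (mpoly.mpolyC n c)) ->
    (forall i, P (mpoly.mpolyX R (mpoly.mnm1 i))) ->
    (forall p q, P p -> P q -> P (p + q)) ->
    (forall p q, P p -> P q -> P (p * q)) ->
  forall p, P p.
Proof.
move=> PC PX PD PM; apply: mpoly.mpolyind => [|c m p _ _ Pp].
  by rewrite -mpoly.mpolyC0.
apply: PD => //; rewrite -mpoly.mul_mpolyC; apply: (PM) => //.
rewrite mpoly.mpolyXE_id; apply: (big_ind P) => [|p' q'|i _].
- by rewrite -mpoly.mpolyC1.
- exact: PM.
elim: (mpoly.fun_of_multinom m i) => [|e IHe].
  by rewrite expr0 -mpoly.mpolyC1.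
by rewrite exprS; exact: PM.
Qed.

Section Peval.
Context {R : realType} {n : nat}.
Implicit Types (p q : mpoly.mpoly n R) (x y : 'rV[R]_n).

Lemma pevalC c x : peval (mpoly.mpolyC n c) x = c.
Proof. exact: mpoly.mevalC. Qed.

Lemma pevalX i x : peval (mpoly.mpolyX R (mpoly.mnm1 i)) x = x 0 i.
Proof. exact: mpoly.mevalXU. Qed.

Lemma pevalD p q x : peval (p + q) x = peval p x + peval q x.
Proof. exact: mpoly.mevalD. Qed.

Lemma pevalB p q x : peval (p - q) x = peval p x - peval q x.
Proof. exact: mpoly.mevalB. Qed.

Lemma pevalM p q x : peval (p * q) x = peval p x * peval q x.
Proof. exact: mpoly.mevalM. Qed.

Lemma peval_sum (I : Type) (r : seq I) (P : pred I) F x :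
  peval (\sum_(i <- r | P i) F i) x = \sum_(i <- r | P i) peval (F i) x.
Proof. exact: (raddf_sum (mpoly.meval (fun i => x 0 i))). Qed.

Lemma peval_prod (I : Type) (r : seq I) (P : pred I) F x :
  peval (\prod_(i <- r | P i) F i) x = \prod_(i <- r | P i) peval (F i) x.
Proof. exact: (rmorph_prod (mpoly.meval (fun i => x 0 i))). Qed.

Lemma mderiv_var (i j : 'I_n) :
  mpoly.mderiv i (mpoly.mpolyX R (mpoly.mnm1 j)) = mpoly.mpolyC n (i == j)%:R.
Proof.
rewrite mpoly.mderivX mpoly.mnm1E eq_sym; case: eqVneq => [->|_].
  by rewrite scale1r -{1}[mpoly.mnm1 j]mpoly.add0m mpoly.addmK mpoly.mpolyX0
             mpoly.mpolyC1.
by rewrite scale0r mpoly.mpolyC0.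
Qed.

Lemma peval_continuous p : continuous (peval p).
Proof.
elim/mpoly_alg_ind: p => [c|i|p q cp cq|p q cp cq] x.
- by rewrite (funext (pevalC c)); exact: cst_continuous.
- by rewrite (funext (pevalX i)); exact: coord_continuous.
- by rewrite (funext (pevalD p q)); exact: cvgD (cp x) (cq x).
- by rewrite (funext (pevalM p q)); exact: cvgM (cp x) (cq x).
Qed.

(** The gradient extended off the diagonal to a function of two points. Joint continuity lets the
    sign of a directional derivative at a point persist for all difference quotients near it. *)
Definition difference_quotient p (A : 'I_n -> 'rV[R]_n -> 'rV[R]_n -> R) :=
  [/\ forall i, continuous (fun z : 'rV[R]_n * 'rV[R]_n => A i z.1 z.2),
      forall x y, peval p y - peval p x = \sum_i (y 0 i - x 0 i) * A i x y &
      forall x i, A i x x = gradient p x 0 i].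

(* Hadamard's lemma *)
Lemma difference_quotient_exists p : exists A, difference_quotient p A.
Proof.
elim/mpoly_alg_ind: p => [c|j|p q [A [cA Ap dA]] [B [cB Bq dB]]
                              |p q [A [cA Ap dA]] [B [cB Bq dB]]].
- exists (fun _ _ _ => 0); split=> [i|x y|x i]; first exact: cst_continuous.
    by rewrite !pevalC subrr big1 // => i _; rewrite mulr0.
  by rewrite mxE mpoly.mderivC /peval mpoly.meval0.
- exists (fun i _ _ => (i == j)%:R); split=> [i|x y|x i].
  + exact: cst_continuous.
  + rewrite !pevalX (bigD1 j) //= eqxx mulr1 big1 ?addr0 // => i /negPf ->.
    by rewrite mulr0.
  + by rewrite mxE mderiv_var pevalC.
- exists (fun i x y => A i x y + B i x y); split=> [i|x y|x i].
  + by move=> z; apply: cvgD; [exact: cA|exact: cB].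
  + rewrite !pevalD opprD addrACA Ap Bq -big_split /=.
    by apply: eq_bigr => i _; rewrite mulrDr.
  + by rewrite dA dB !mxE mpoly.mderivD pevalD.
(* The discrete Leibniz rule: [p] changes first, with [q] taken at [y], then [q], with [p] taken at
   [x]. *)
- exists (fun i x y => A i x y * peval q y + peval p x * B i x y).
  split=> [i|x y|x i].
  + move=> z; apply: cvgD; apply: cvgM; [exact: cA| | |exact: cB].
      by apply: (cvg_comp snd (peval q) cvg_snd); exact: peval_continuous.
    by apply: (cvg_comp fst (peval p) cvg_fst); exact: peval_continuous.
  + rewrite !pevalM.
    transitivity ((peval p y - peval p x) * peval q y
                  + peval p x * (peval q y - peval q x)); first by ring.
    rewrite Ap Bq mulr_suml mulr_sumr -big_split /=.
    by apply: eq_bigr => i _; ring.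
  + by rewrite dA dB !mxE mpoly.mderivM pevalD !pevalM.
Qed.

End Peval.

(** * Tangent vectors and independence of gradients *)

Lemma is_derive_curve (R : realType) (n : nat) (x v w : 'rV[R]_n) (s : R -> R)
    (t ds : R) :
  is_derive t 1 s ds ->
  is_derive t 1 (fun t => x + t *: v + s t *: w) (v + ds *: w).
Proof.
move=> [sD sE].
have E : h^-1 *: ((fun t => x + t *: v + s t *: w) (h *: 1 + t)
    - (x + t *: v + s t *: w)) @[h --> (0 : R)^'] --> v + ds *: w.
  apply: (@cvg_trans _ (v + (h^-1 *: (s (h *: 1 + t) - s t)) *: w
    @[h --> (0 : R)^'])); last first.
    apply: cvgD; first exact: cvg_cst.
    by apply: cvgZ; [rewrite -sE; exact: sD|exact: cvg_cst].
  apply: near_eq_cvg; near=> h.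
  have h0 : h != 0 by near: h; exact: nbhs_dnbhs_neq.
  apply/rowP => i; rewrite !mxE /GRing.scale /= mulr1.
  by field.
by split; [apply/cvg_ex; eexists; exact: E|exact: cvg_lim E].
Unshelve. all: by end_near. Qed.

(* The implicit function theorem along the plane [x + t v + s (gradient p x)]. *)
Lemma tangent_space_gradient (R : realType) (n : nat) (p : mpoly.mpoly n R)
    (x v : 'rV[R]_n) :
  zero_set p x -> gradient p x != 0 -> \sum_i v 0 i * gradient p x 0 i = 0 ->
  tangent_space (zero_set p) x v.
Proof.
move=> px0 w0 vw; set w := gradient p x in w0 vw.
have [A [cA pA gA]] := difference_quotient_exists p.
pose path (z : R * R) : 'rV[R]_n := x + z.1 *: v + z.2 *: w.
have cpath : continuous path.
  move=> z; apply: cvgD; [apply: cvgD; first exact: cvg_cst|];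
    by apply: cvgZ; [|exact: cvg_cst]; [exact: cvg_fst || exact: cvg_snd].
(* Along the plane, [p] changes by the change of [t] times [slope v] plus the change of [s] times
   [slope w]. At the origin these slopes are 0 and the squared norm of [w]. *)
pose slope (u : 'rV[R]_n) (z : (R * R) * (R * R)) :=
  \sum_i u 0 i * A i (path z.1) (path z.2).
have cslope u : continuous (slope u).
  have cpath2 : continuous (fun z : (R * R) * (R * R) => (path z.1, path z.2)).
    apply: continuous_pair => z.
      by apply: (@continuous_comp _ _ _ fst path z); [exact: cvg_fst|exact: cpath].
    by apply: (@continuous_comp _ _ _ snd path z); [exact: cvg_snd|exact: cpath].
  move=> z; apply: (cvg_big add_continuous) => i _.
  by apply: cvgM; [exact: cvg_cst|exact: (continuous_comp (cpath2 z) (cA i _))].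
pose a := slope v; pose b := slope w.
have pE z z' : peval p (path z') - peval p (path z) =
    (z'.1 - z.1) * a (z, z') + (z'.2 - z.2) * b (z, z').
  rewrite pA /a /b /slope !mulr_sumr -big_split /=; apply: eq_bigr => i _.
  by rewrite !mxE; ring.
have path0 : path (0, 0) = x by rewrite /path /= !scale0r !addr0.
have a0 : a ((0, 0), (0, 0)) = 0.
  by rewrite /a /slope /= path0 -[RHS]vw; apply: eq_bigr => i _; rewrite gA.
have b0 : 0 < b ((0, 0), (0, 0)).
  rewrite /b /slope /= path0.
  have [i wi] : exists i, w 0 i != 0.
    apply/existsP; rewrite -negb_forall; apply: contra w0 => /forallP w0.
    by apply/eqP/rowP => i; rewrite [RHS]mxE; exact/eqP.
  rewrite (bigD1 i) //= ltr_pwDl //.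
    by rewrite gA -/w -expr2 exprn_even_gt0.
  by apply: sumr_ge0 => j _; rewrite gA -/w -expr2 sqr_ge0.
(* Half the slope along [w] at the origin separates the two slopes: near the origin
   [|a| < c < b]. *)
pose c := b ((0, 0), (0, 0)) / 2.
have c0 : 0 < c by rewrite divr_gt0.
have [e e0 He] : exists2 e : R, 0 < e & forall t s t' s', `|t| < e -> `|s| < e ->
    `|t'| < e -> `|s'| < e ->
    `|a ((t, s), (t', s'))| < c /\ c < b ((t, s), (t', s')).
  have : \forall z \near ((0, 0), (0, 0)), `|a z| < c /\ c < b z.
    near=> z; split; near: z.
      apply: (@cvgr_norm_lt _ R^o _ _ _ a 0); last by rewrite normr0.
      by rewrite -[X in _ --> X]a0; exact: cslope.
    apply: (@cvgr_gt _ _ _ _ b (b ((0, 0), (0, 0)))); first exact: cslope.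
    by rewrite /c; lra.
  move=> /nbhs_ballP[e /= e0 He]; exists e => // t s t' s' te se te' se'.
  by apply: He; split; split; rewrite /ball /= sub0r normrN.

have lt_e (y : R) : `|y| <= e / 2 -> `|y| < e.
  by move=> ye; rewrite (le_lt_trans ye) // ltr_pdivrMr // ltr_pMr // ltr1n.
(* At [s = e / 2] and [s = - (e / 2)] the term [s * b] dominates [t * a], so [p] takes values of
   opposite weak signs and vanishes in between. For larger [t] the value 0 is a mere default. *)
have sol t : exists s, `|t| <= e / 2 ->
    `|s| <= e / 2 /\ peval p (path (t, s)) = 0.
  have [te|te] := leP `|t| (e / 2); last by exists 0.
  have e2 : 0 < e / 2 by rewrite divr_gt0.
  have E s : peval p (path (t, s)) = t * a ((0, 0), (t, s)) + s * b ((0, 0), (t, s)).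
    by have := pE (0, 0) (t, s); rewrite path0 px0 !subr0.
  have ta s : `|s| <= e / 2 -> `|t * a ((0, 0), (t, s))| <= e / 2 * c.
    move=> se; rewrite normrM ler_pM // ltW //.
    by case: (He 0 0 t s); rewrite ?normr0 ?lt_e.
  have bc s : `|s| <= e / 2 -> e / 2 * c <= e / 2 * b ((0, 0), (t, s)).
    move=> se; rewrite ler_pM2l // ltW //.
    by case: (He 0 0 t s); rewrite ?normr0 ?lt_e.
  have [|||s se ps] := @IVT R (fun s => peval p (path (t, s))) (- (e / 2)) (e / 2) 0.
  - by rewrite ge0_cp // ltW.
  - apply: continuous_subspaceT => s.
    apply: (@continuous_comp _ _ _ (fun s => path (t, s)) (peval p)).
      apply: (@continuous_comp _ _ _ (fun s => (t, s)) path); last exact: cpath.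
      by apply: continuous_pair => ?; [exact: cvg_cst|exact: cvg_id].
    exact: peval_continuous.
  - have e2e : `|e / 2| <= e / 2 by rewrite ger0_norm // ltW.
    rewrite ge_min le_max !E; apply/andP; split; apply/orP; [left|right].
      have := ta (- (e / 2)); have := bc (- (e / 2)); rewrite normrN.
      by move=> /(_ e2e) ? /(_ e2e); rewrite ler_norml => /andP[? ?]; lra.
    have := ta (e / 2); have := bc (e / 2).
    by move=> /(_ e2e) ? /(_ e2e); rewrite ler_norml => /andP[? ?]; lra.
  by exists s => _; split=> //; rewrite ler_norml; move: se; rewrite in_itv.
have [s Hs] := choice sol.
(* Both points of the curve are zeros of [p], so the two contributions to its change cancel. *)
have sE t t' : `|t| <= e / 2 -> `|t'| <= e / 2 ->
    s t' - s t = - (t' - t) * (a ((t, s t), (t', s t')) / b ((t, s t), (t', s t'))).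
  move=> te te'; have [ste pt] := Hs t te; have [ste' pt'] := Hs t' te'.
  have := pE (t, s t) (t', s t'); rewrite pt pt' subrr /= => /esym/eqP.
  rewrite addr_eq0 => /eqP E.
  have [_ cb] := He t (s t) t' (s t') (lt_e _ te) (lt_e _ ste) (lt_e _ te') (lt_e _ ste').
  have b_neq0 : b ((t, s t), (t', s t')) != 0 by rewrite gt_eqF // (lt_trans c0).
  by rewrite mulrA mulNr E opprK mulfK.
have e2 : 0 < e / 2 by rewrite divr_gt0.
have s0 : s 0 = 0.
  have [s0e ps0] : `|s 0| <= e / 2 /\ peval p (path (0, s 0)) = 0.
    by apply: Hs; rewrite normr0 ltW.
  have := pE (0, 0) (0, s 0); rewrite path0 px0 ps0 !subr0 /= mul0r add0r.
  move=> /esym/eqP; rewrite mulf_eq0 => /orP[/eqP //|].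
  have [|||| _ cb] := He 0 0 0 (s 0); rewrite ?normr0 ?lt_e //.
  by rewrite gt_eqF // (lt_trans c0).
(* The function [s] comes from bare choice; its continuity follows because the quotient [a / b] has
   absolute value below 1. *)
have s_lip t t' : `|t| <= e / 2 -> `|t'| <= e / 2 -> `|s t' - s t| <= `|t' - t|.
  move=> te te'; have [ste _] := Hs t te; have [ste' _] := Hs t' te'.
  rewrite sE // normrM normrN ler_piMr // normrM normfV.
  have [ac cb] := He t (s t) t' (s t') (lt_e _ te) (lt_e _ ste) (lt_e _ te') (lt_e _ ste').
  have b_gt0 := lt_trans c0 cb.
  by rewrite (gtr0_norm b_gt0) ler_pdivrMr // mul1r ltW // (lt_trans ac).
have near_e (t : R) : `|t| < e / 2 -> \forall t' \near t, `|t'| < e / 2.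
  by move=> te; exact: (@cvgr_norm_lt R R^o R (nbhs t) _ id t cvg_id _ te).
have s_cont (t : R) : `|t| < e / 2 -> {for t, continuous s}.
  move=> te; apply/cvgrPdist_le => d d0; near=> t'.
  have te' : `|t'| < e / 2 by near: t'; exact: near_e.
  rewrite distrC; apply: le_trans (s_lip t t' (ltW te) (ltW te')) _.
  by rewrite distrC; near: t'; move: d d0; apply/cvgrPdist_le; exact: cvg_id.
(* The difference quotient of [s] between [t] and [t']. It is continuous in [t'] at [t], so its
   diagonal value is the derivative. *)
pose q t t' := - (a ((t, s t), (t', s t')) / b ((t, s t), (t', s t'))).
have s_der (t : R) : `|t| < e / 2 -> is_derive t 1 s (q t t).
  move=> te.
  have tst : {for t, continuous (fun t' => ((t, s t), (t', s t')))}.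
    have ts : {for t, continuous (fun t' => (t', s t'))}.
      exact: (cvg_pair cvg_id (s_cont t te)).
    exact: (cvg_pair (@cst_continuous _ _ (t, s t) t) ts).
  have [ste pt] := Hs t (ltW te).
  have [_ cb] := He t (s t) t (s t) (lt_e _ (ltW te)) (lt_e _ ste) (lt_e _ (ltW te)) (lt_e _ ste).
  have q_cont : {for t, continuous (q t)}.
    apply: cvgN; apply: cvgM.
      exact: (continuous_comp tst (cslope v _)).
    apply: cvgV; first by rewrite gt_eqF // (lt_trans c0).
    exact: (continuous_comp tst (cslope w _)).
  have shift : h *: 1 + t @[h --> (0 : R)] --> t.
    rewrite (_ : (fun h => _) = fun h => h + t); last first.
      by apply/funext => h; rewrite /GRing.scale /= mulr1.
    by rewrite -[X in _ --> X]add0r; exact: cvgD cvg_id (@cst_continuous _ _ t 0).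
  have shift_e := @cvgr_norm_lt R R^o R (nbhs 0) _ _ t shift _ te.
  have E : h^-1 *: (s (h *: 1 + t) - s t) @[h --> (0 : R)^'] --> q t t.
    apply: (@cvg_trans _ (q t (h *: 1 + t) @[h --> (0 : R)^'])).
      apply: near_eq_cvg; near=> h.
      have h0 : h != 0 by near: h; exact: nbhs_dnbhs_neq.
      rewrite sE; [|exact: ltW|].
        by rewrite /q /GRing.scale /= mulr1 addrK mulNr mulrN mulKf.
      by apply/ltW; near: h; apply: nbhs_dnbhs; exact: shift_e.
    exact: cvg_comp (cvg_trans (cvg_app _ (@nbhs_dnbhs _ 0)) shift) q_cont.
  by split; [apply/cvg_ex; eexists; exact: E|exact: cvg_lim E].
have path_der (t : R) : `|t| < e / 2 ->
    is_derive t 1 (fun t => path (t, s t)) (v + q t t *: w).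
  by move=> te; apply: is_derive_curve; exact: s_der.
have norm0_e : `|0 : R| < e / 2 by rewrite normr0.
exists (fun t => path (t, s t)); split.
- by rewrite s0 path0.
- near=> t; have te : `|t| < e / 2 by near: t; exact: near_e.
  by split; [case: (Hs t (ltW te))|case: (path_der t te)].
(* The slope along [v] vanishes at the origin by the orthogonality of [v] and the gradient, so the
   initial velocity is exactly [v]. *)
- have [_ ->] := path_der 0 norm0_e.
  by rewrite /q s0 a0 mul0r oppr0 scale0r addr0.
Unshelve. all: by end_near. Qed.

(** The kernel of [J] embeds in a space of dimension [d = n - l], which forces the rank of [J] to be
    at least [l]. *)
Lemma row_free_of_has_dim (R : realType) (n l d : nat) (J : 'M[R]_(l, n))
    (A : set 'rV[R]_n) :
  (forall v, v *m J^T = 0 -> A v) -> has_dim A d -> (d + l = n)%N -> row_free J.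
Proof.
move=> JA [V AV dimV] dln.
pose K := row_base (kermx J^T).
pose F : 'Hom('rV[R]_(\rank (kermx J^T)), 'rV[R]_n) := linfun (mulmxr K).
have Finj : lker F == 0%VS.
  apply/lker0P => u v; rewrite !lfunE /=.
  by apply: row_free_inj; exact: row_base_free.
have FV : (limg F <= V)%VS.
  apply/subvP => _ /memv_imgP[u _ ->]; rewrite lfunE /=.
  have : A (u *m K); last by rewrite AV.
  apply: JA; apply/eqP; rewrite -[_ == 0]/(u *m K *m J^T == 0) -sub_kermx.
  by rewrite (submx_trans (submxMl _ _)) // eq_row_base.
have := limg_dim_eq; move=> /(_ _ _ _ F fullv).
rewrite (eqP Finj) capv0 dimvf /dim /= mul1n => /(_ erefl) dimF.
have := dimvS FV; rewrite dimF dimV mxrank_ker mxrank_tr => rk.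
rewrite /row_free eqn_leq rank_leq_row /=.
have := rank_leq_col J; lia.
Qed.

(** Turns a set of indices into an increasing sequence, the form in which conditions (2) and (3) are
    stated. *)
Lemma enum_val_ltn (l : nat) (A : {set 'I_l}) (a b : 'I_#|A|) :
  (a < b)%N -> (enum_val a < enum_val b)%N.
Proof.
move=> ab; have lA : sorted ltn (map val (enum A)).
  rewrite sorted_map /enum_mem; apply: sorted_filter.
    by move=> y x z /=; exact: ltn_trans.
  by rewrite -sorted_map -enumT val_enum_ord iota_ltn_sorted.
have x0 : 'I_l := enum_val a.
rewrite (enum_val_nth x0 a) (enum_val_nth x0 b).
rewrite -(nth_map x0 0%N) -?cardE // -(nth_map x0 0%N) -?cardE //.
by apply: (sorted_ltn_nth ltn_trans); rewrite ?inE ?size_map -?cardE.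
Qed.

(** A vector orthogonal to all the gradients is tangent to every hypersurface, so the dimension of
    the common tangent space makes the gradients independent. The columns of a right inverse of
    their matrix are then dual to them. *)
Lemma dual_frame (R : realType) (l n : nat) (f_ : 'I_l -> mpoly.mpoly n R)
    (A : {set 'I_l}) (p : 'rV[R]_n) (d : nat) :
    (forall j, j \in A -> zero_set (f_ j) p) ->
    (forall j, j \in A -> gradient (f_ j) p != 0) ->
    has_dim (\bigcap_(i in [set: 'I_#|A|])
      tangent_space (zero_set (f_ (enum_val i))) p) d ->
    (d + #|A| = n)%N ->
  exists v : 'I_l -> 'rV[R]_n, {in A &, forall j j',
    \sum_i v j 0 i * gradient (f_ j') p 0 i = (j' == j)%:R}.
Proof.
move=> fp gp dimT dA; pose J := jacobian_mx (fun i : 'I_#|A| => f_ (enum_val i)) p.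
have /row_freeP[B JB] : row_free J.
  apply: row_free_of_has_dim dimT dA => v vJ i _.
  apply: tangent_space_gradient; [exact/fp/enum_valP|exact/gp/enum_valP|].
  move/rowP : vJ => /(_ i); rewrite !mxE; apply: etrans.
  by apply: eq_bigr => j _; rewrite !mxE.
(* Indices outside [A] receive the default vector 0. *)
exists (fun j => if [pick i : 'I_#|A| | enum_val i == j] is Some i
  then (col i B)^T else 0) => j j' jA j'A.
case: pickP => [i /eqP <-|/(_ (enum_rank_in jA j))]; last first.
  by rewrite enum_rankK_in ?eqxx.
move/matrixP: JB => /(_ (enum_rank_in j'A j') i); rewrite !mxE.
rewrite -(inj_eq enum_val_inj) enum_rankK_in //; apply: etrans.
by apply: eq_bigr => k _; rewrite !mxE enum_rankK_in // mulrC.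
Qed.

(** * Smooth maps *)

Section ClassC.
Context {R : realType}.

Lemma class_C_continuous (V W : normedModType R) k (U : set V) (f : V -> W) :
  class_C k U f -> forall x, U x -> {for x, continuous f}.
Proof. by case: k => [|k] []. Qed.

Lemma class_C_pred (V W : normedModType R) k (U : set V) (f : V -> W) :
  class_C k.+1 U f -> class_C k U f.
Proof.
elim: k f => [|k IHk] f [cf [df Df]]; first by split.
by split=> //; split=> // v; apply: IHk; exact: Df.
Qed.

Lemma class_C_subset (V W : normedModType R) k (U U' : set V) (f : V -> W) :
  U `<=` U' -> class_C k U' f -> class_C k U f.
Proof.
move=> UU'; elim: k f => [|k IHk] f [cf Df]; split;
  do ?[by move=> x Ux; exact: (cf x (UU' x Ux))].
  by [].
case: Df => df Df; split=> [x v Ux|v]; last exact: (IHk _ (Df v)).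
exact: (df x v (UU' x Ux)).
Qed.

(** Openness makes [f] and [g] agree near each point of [U], so their derivatives agree on [U] as
    well. Derivative formulas that hold only on [U] enter the inductions below through this
    lemma. *)
Lemma class_C_eq (V W : normedModType R) k (U : set V) (f g : V -> W) :
  open U -> (forall x, U x -> f x = g x) -> class_C k U f -> class_C k U g.
Proof.
move=> oU; have near_U x : U x -> \forall y \near x, U y.
  by move=> Ux; exact: open_nbhs_nbhs.
have cont (f1 f2 : V -> W) : (forall x, U x -> f1 x = f2 x) ->
    (forall x, U x -> {for x, continuous f1}) ->
    forall x, U x -> {for x, continuous f2}.
  move=> fE cf x Ux; suff : f2 @ x --> f2 x by [].
  rewrite -(fE x Ux).
  apply: cvg_trans (cf x Ux); apply: near_eq_cvg.
  by apply: filterS (near_U x Ux) => y Uy; rewrite fE.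
elim: k f g => [|k IHk] f g fg [cf Df]; split; do ?exact: (cont f g).
  by [].
case: Df => df Df; split=> [x v Ux|v].
  apply: near_eq_derivable (df x v Ux).
  by apply: filterS (near_U x Ux) => y /fg.
apply: (IHk _ _ _ (Df v)) => x Ux; apply: near_eq_derive.
by apply: filterS (near_U x Ux) => y /fg.
Qed.

Lemma class_C_cst (V W : normedModType R) k (U : set V) (c : W) :
  class_C k U (fun _ => c).
Proof.
elim: k c => [|k IHk] c; split=> [x _|] //; do ?exact: cst_continuous.
split=> [x v _|v]; first exact: derivable_cst.
have -> : (fun x => 'D_v (fun=> c : W) x) = (fun=> 0) :> (V -> W).
  by apply/funext => x; rewrite derive_cst.
exact: IHk.
Qed.

Lemma class_CD (V W : normedModType R) k (U : set V) (f g : V -> W) :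
  open U -> class_C k U f -> class_C k U g -> class_C k U (fun x => f x + g x).
Proof.
move=> oU; elim: k f g => [|k IHk] f g [cf Df] [cg Dg]; split;
  do ?[by move=> x Ux; apply: cvgD; [exact: cf|exact: cg]].
  by [].
case: Df Dg => df Df [dg Dg]; split=> [x v Ux|v].
  by apply: derivableD; [exact: df|exact: dg].
apply: (class_C_eq oU _ (IHk _ _ (Df v) (Dg v))) => x Ux.
by rewrite (deriveD (df x v Ux) (dg x v Ux)).
Qed.

Lemma class_CM (V : normedModType R) k (U : set V) (f g : V -> R^o) :
  open U -> class_C k U f -> class_C k U g ->
  class_C k U (fun x => f x * g x : R^o).
Proof.
move=> oU; elim: k f g => [|k IHk] f g Cf Cg; have [cf Df] := Cf;
  have [cg Dg] := Cg; split;
  do ?[by move=> x Ux; apply: cvgM; [exact: cf|exact: cg]].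
  by [].
case: Df Dg => df Df [dg Dg]; split=> [x v Ux|v].
  by apply: derivableM; [exact: df|exact: dg].
apply: (class_C_eq oU (f := fun x => f x * 'D_v g x + g x * 'D_v f x)) => [x Ux|].
  by rewrite (deriveM (df x v Ux) (dg x v Ux)).
by apply: class_CD => //; apply: IHk;
  [exact: class_C_pred|exact: Dg|exact: class_C_pred|exact: Df].
Qed.

Lemma class_CV (V : normedModType R) k (U : set V) (f : V -> R^o) :
  open U -> (forall x, U x -> f x != 0) -> class_C k U f ->
  class_C k U (fun x => (f x)^-1 : R^o).
Proof.
move=> oU f0; elim: k => [|k IHk] Cf; have [cf Df] := Cf; split;
  do ?[by move=> x Ux; apply: cvgV; [exact: f0|exact: cf]].
  by [].
case: Df => df Df; split=> [x v Ux|v].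
  by apply: derivableV; [exact: f0|exact: df].
have Cf' := IHk (class_C_pred Cf).
(* The derivative of the inverse is written through the inverse itself, whose regularity of order
   [k] is the induction hypothesis. *)
apply: (class_C_eq oU (f := fun x => -1 * ((f x)^-1 * (f x)^-1) * 'D_v f x)) => [x Ux|].
  by rewrite (deriveV (f0 x Ux) (df x v Ux)) /GRing.scale /= -exprVn mulN1r.
apply: class_CM; [by []| |exact: Df].
by apply: class_CM; [|exact: class_C_cst|exact: class_CM].
Qed.

Lemma class_C_sum (V : normedModType R) k (U : set V) (I : Type) (r : seq I)
    (P : pred I) (f : I -> V -> R^o) :
  open U -> (forall i, P i -> class_C k U (f i)) ->
  class_C k U (fun x => \sum_(i <- r | P i) f i x : R^o).
Proof.
move=> oU Cf; elim: r => [|i r IHr].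
  rewrite (_ : (fun x => _) = fun=> 0); first exact: class_C_cst.
  by apply/funext => x; rewrite big_nil.
have [Pi|Pi] := boolP (P i); last first.
  rewrite (_ : (fun x => _) = fun x => \sum_(i <- r | P i) f i x) //.
  by apply/funext => x; rewrite big_cons (negPf Pi).
rewrite (_ : (fun x => _) = fun x => f i x + \sum_(i <- r | P i) f i x).
  by apply: class_CD => //; exact: Cf.
by apply/funext => x; rewrite big_cons Pi.
Qed.

(** Here [L] is affine with linear part [L']. The difference quotients of [f \o L] along [v] are
    literally those of [f] along [L' v], so no general chain rule enters. *)
Lemma class_C_comp_affine (V V' W : normedModType R) k (U : set V) (f : V -> W)
    (L : V' -> V) (L' : V' -> V) :
  continuous L -> (forall (h : R) v x, L (h *: v + x) = h *: L' v + L x) ->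
  class_C k U f -> class_C k (L @^-1` U) (f \o L).
Proof.
move=> cL LE.
have rateE (g : V -> W) (v x : V') : (fun h : R => h^-1 *: ((g \o L) (h *: v + x) - (g \o L) x))
    = (fun h : R => h^-1 *: (g (h *: L' v + L x) - g (L x))).
  by apply/funext => h /=; rewrite LE.
elim: k f => [|k IHk] f [cf Df]; split;
  do ?[by move=> x Ux; apply: continuous_comp; [exact: cL|exact: cf]].
  by [].
case: Df => df Df; split=> [x v Ux|v].
  by have := df (L x) (L' v) Ux; rewrite /derivable /= rateE.
have -> : (fun x => 'D_v (f \o L) x) = (fun x => 'D_(L' v) f x) \o L.
  by apply/funext => x; rewrite /derive /= rateE.
exact: (IHk _ (Df (L' v))).
Qed.

Lemma is_derive_rV (V : normedModType R) n (f : V -> 'rV[R]_n) (x v : V)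
    (d : 'rV[R]_n) :
  (forall i, is_derive x v (fun y => f y 0 i : R^o) (d 0 i)) -> is_derive x v f d.
Proof.
move=> fd.
have E : h^-1 *: (f (h *: v + x) - f x) @[h --> (0 : R)^'] --> d.
  apply: cvg_rV => i; have [fid <-] := fd i.
  rewrite (_ : (fun h => _) = fun h => h^-1 *: ((f (h *: v + x) 0 i : R^o) - f x 0 i)).
    exact: fid.
  by apply/funext => h; rewrite !mxE.
by split; [apply/cvg_ex; eexists; exact: E|exact: cvg_lim E].
Qed.

Lemma is_derive_coord (V : normedModType R) n (f : V -> 'rV[R]_n) (x v : V) i :
  derivable f x v -> is_derive x v (fun y => f y 0 i : R^o) ('D_v f x 0 i).
Proof.
move=> fd.
have fd' : h^-1 *: (f (h *: v + x) - f x) @[h --> (0 : R)^'] --> 'D_v f x by exact: fd.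
have E : h^-1 *: ((f (h *: v + x) 0 i : R^o) - f x 0 i) @[h --> (0 : R)^'] --> ('D_v f x 0 i : R^o).
  rewrite (_ : (fun h => _) = fun h => (h^-1 *: (f (h *: v + x) - f x)) 0 i).
    exact: (cvg_comp _ _ fd' (@coord_continuous R 1 n 0 i ('D_v f x))).
  by apply/funext => h; rewrite !mxE.
by split; [apply/cvg_ex; eexists; exact: E|exact: cvg_lim E].
Qed.

Lemma class_C_rV (V : normedModType R) n k (U : set V) (f : V -> 'rV[R]_n) :
  open U -> (forall i, class_C k U (fun x => f x 0 i : R^o)) -> class_C k U f.
Proof.
move=> oU; elim: k f => [|k IHk] f Cf; split; do ?[by move=> x Ux; apply: cvg_rV => i;
  exact: (class_C_continuous (Cf i))].
  by [].
have dE x v : U x -> is_derive x v f (\row_i 'D_v (fun y => f y 0 i : R^o) x).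
  move=> Ux; apply: is_derive_rV => i; rewrite mxE.
  by have [_ [df _]] := Cf i; split=> //; exact: df.
split=> [x v Ux|v]; first by case: (dE x v Ux).
apply: IHk => i; have [_ [_ /(_ v)]] := Cf i.
apply: class_C_eq => // x Ux.
by have [_ ->] := dE x v Ux; rewrite mxE.
Qed.

Lemma class_C_coord (V : normedModType R) n k (U : set V) (f : V -> 'rV[R]_n) i :
  open U -> class_C k U f -> class_C k U (fun x => f x 0 i : R^o).
Proof.
move=> oU; elim: k f => [|k IHk] f [cf Df]; split;
  do ?[by move=> x Ux; exact: (cvg_comp _ _ (cf x Ux) (@coord_continuous _ _ _ 0 i _))].
  by [].
case: Df => df Df; split=> [x v Ux|v].
  by case: (is_derive_coord i (df x v Ux)).
apply: (class_C_eq oU _ (IHk _ (Df v))) => x Ux.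
by case: (is_derive_coord i (df x v Ux)).
Qed.

Lemma class_C_id (V : normedModType R) k (U : set V) : class_C k U (fun x : V => x).
Proof.
have dE (x v : V) : is_derive x v (fun x : V => x) v by exact: is_derive_id.
case: k => [|k]; split=> [x _|] //; do ?exact: cvg_id.
split=> [x v _|v]; first by case: (dE x v).
have -> : (fun x => 'D_v (fun x : V => x) x) = (fun=> v).
  by apply/funext => x; case: (dE x v).
exact: class_C_cst.
Qed.

End ClassC.

(** * Products of spheres *)

Lemma choice_dep (I : Type) (T : I -> Type) (P : forall i, T i -> Prop) :
  (forall i, exists x, P i x) -> exists f : forall i, T i, forall i, P i (f i).
Proof.
by move=> HP; exists (fun i => projT1 (cid (HP i))) => i; exact: projT2 (cid (HP i)).
Qed.

Section Blocks.
Context {R : realType} {n l2 r : nat}.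
Variables (mu : 'I_l2 -> nat) (iota : 'I_r -> 'I_l2) (d_ : 'I_r -> nat).
Hypothesis iota_inj : injective iota.

Local Notation k := (\sum_(b < l2) (mu b).+1)%N.

Definition block (b : 'I_l2) (x : 'rV[R]_(n + k)) : 'rV[R]_(mu b).+1 :=
  submxrow (rsubmx x) b.

(** The shape of a fibre over [p]: [iota] lists the blocks that carry a genuine factor, and the
    remaining blocks are collapsed to the origin. *)
Definition block_product (p : 'rV[R]_n)
    (X : forall i, set 'rV[R]_(mu (iota i)).+1) : set 'rV[R]_(n + k) :=
  [set x | [/\ lsubmx x = p, forall i, X i (block (iota i) x) &
    forall b, b \notin codom iota -> block b x = 0]].

(** For unit spheres this unfolds to [sphere_product]; for open factors it is the target of a
    product chart. *)
Definition row_product (Z : forall i, set 'rV[R]_(d_ i)) :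
    set 'rV[R]_(\sum_(i < r) d_ i) :=
  [set z | forall i, Z i (submxrow z i)].

Lemma block_affine b (t : R) v x : block b (t *: v + x) = t *: block b v + block b x.
Proof. by apply/rowP => i; rewrite !mxE. Qed.

Lemma block_continuous b : continuous (block b).
Proof.
apply: continuous_rV => i; rewrite (_ : (fun x => _) =
  fun x : 'rV[R]_(n + k) => x 0 (rshift n (tagnat.Rank b i))).
  exact: coord_continuous.
by apply/funext => x; rewrite !mxE.
Qed.

Lemma submxrow_affine i (t : R) (v x : 'rV[R]_(\sum_(i < r) d_ i)) :
  submxrow (t *: v + x) i = t *: submxrow v i + submxrow x i.
Proof. by apply/rowP => l; rewrite !mxE. Qed.

Lemma submxrow_continuous i :
  continuous (fun z : 'rV[R]_(\sum_(i < r) d_ i) => submxrow z i).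
Proof.
apply: continuous_rV => l; rewrite (_ : (fun x => _) =
  fun x : 'rV[R]_(\sum_(i < r) d_ i) => x 0 (tagnat.Rank i l)).
  exact: coord_continuous.
by apply/funext => x; rewrite !mxE.
Qed.

Lemma open_forall (T : topologicalType) (I : finType) (U : I -> set T) :
  (forall i, open (U i)) -> open [set x | forall i, U i x].
Proof.
move=> oU; rewrite openE => x Ux.
apply: (@filter_forall _ _ U (nbhs x)) => i.
by apply: open_nbhs_nbhs; split; [exact: oU|exact: Ux].
Qed.

(** The maps act block by block. Local smooth extensions of the factors combine on the set where
    every block lies in its own domain, which is open because the blocks are finitely many. *)
Lemma diffeomorphic_blocks p (X : forall i, set 'rV[R]_(mu (iota i)).+1)
    (Z : forall i, set 'rV[R]_(d_ i)) :
  (forall i, diffeomorphic (X i) (Z i)) ->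
  diffeomorphic (block_product p X) (row_product Z).
Proof.
move=> XZ.
have [F HF] : exists F : forall i, 'rV[R]_(mu (iota i)).+1 -> 'rV[R]_(d_ i),
    forall i, exists g, [/\ smooth_map (X i) (F i), smooth_map (Z i) g,
        forall x, X i x -> Z i (F i x) /\ g (F i x) = x &
        forall y, Z i y -> X i (g y) /\ F i (g y) = y].
  exact: (choice_dep XZ).
have [G HG] := choice_dep HF.
pose phi (x : 'rV[R]_(n + k)) : 'rV[R]_(\sum_(i < r) d_ i) :=
  \mxrow_i F i (block (iota i) x).
(* By injectivity of [iota] the sum has one term on a listed block; on any other block it is empty
   and gives 0. The coordinate index is moved between the equal types of [iota i] and [b] by
   [inord], without a cast. *)
pose lin (H : forall i, 'rV[R]_(d_ i) -> 'rV[R]_(mu (iota i)).+1)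
    (z : 'rV[R]_(\sum_(i < r) d_ i)) : 'rV[R]_(n + k) :=
  row_mx p (\mxrow_b (\row_l \sum_(i | iota i == b) H i (submxrow z i) 0 (inord l))).
have linE H z i : block (iota i) (lin H z) = H i (submxrow z i).
  rewrite /block /lin row_mxKr mxrowK; apply/rowP => l; rewrite mxE.
  rewrite (bigD1 i) //= inord_val big1 ?addr0 // => i' /andP[/eqP ii' i'i].
  by rewrite (iota_inj ii') eqxx in i'i.
exists phi, (lin G); split.
- move=> x Xx; have [_ Xi _] := Xx.
  have HU i : exists Ug : set 'rV[R]_(mu (iota i)).+1 *
      ('rV[R]_(mu (iota i)).+1 -> 'rV[R]_(d_ i)),
      [/\ open Ug.1, Ug.1 (block (iota i) x), smooth_on Ug.1 Ug.2 &
        forall y, X i y -> Ug.1 y -> F i y = Ug.2 y].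
    by have [/(_ _ (Xi i))[U [g Ug]] _ _ _] := HG i; exists (U, g).
  have [Ug HUg] := choice_dep HU.
  pose U := [set y : 'rV[R]_(n + k) | forall i, (Ug i).1 (block (iota i) y)].
  have oUi i : open (block (iota i) @^-1` (Ug i).1).
    by apply: open_comp => [y _|]; [exact: block_continuous|case: (HUg i)].
  have oU : open U by exact: open_forall.
  exists U, (fun y => \mxrow_i (Ug i).2 (block (iota i) y)); split=> //.
  + by move=> i; case: (HUg i).
  + move=> c; apply: class_C_rV => // j.
    rewrite (_ : (fun x => _) = fun x => ((Ug (tagnat.sig1 j)).2 \o
      block (iota (tagnat.sig1 j))) x 0 (tagnat.sig2 j)); last first.
      by apply/funext => y; rewrite mxE.
    apply: class_C_coord => //.
    apply: (class_C_subset (U' := block (iota (tagnat.sig1 j)) @^-1` (Ug (tagnat.sig1 j)).1)).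
      by move=> y; exact.
    apply: (class_C_comp_affine (L' := block _)) => //.
    * exact: block_continuous.
    * exact: block_affine.
    * by case: (HUg (tagnat.sig1 j)).
  + move=> y [_ Xy _] Uy; apply/mxrowP => i; rewrite !mxrowK.
    by case: (HUg i) => _ _ _; apply.
- move=> z Zz.
  have HU i : exists Ug : set 'rV[R]_(d_ i) *
      ('rV[R]_(d_ i) -> 'rV[R]_(mu (iota i)).+1),
      [/\ open Ug.1, Ug.1 (submxrow z i), smooth_on Ug.1 Ug.2 &
        forall y, Z i y -> Ug.1 y -> G i y = Ug.2 y].
    by have [_ /(_ _ (Zz i))[U [g Ug]] _ _] := HG i; exists (U, g).
  have [Ug HUg] := choice_dep HU.
  pose U := [set y : 'rV[R]_(\sum_(i < r) d_ i) | forall i, (Ug i).1 (submxrow y i)].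
  have oUi i : open ((fun y => submxrow y i) @^-1` (Ug i).1).
    by apply: open_comp => [y _|]; [exact: submxrow_continuous|case: (HUg i)].
  have oU : open U by exact: open_forall.
  exists U, (lin (fun i => (Ug i).2)); split=> //.
  + by move=> i; case: (HUg i).
  + move=> c; apply: class_C_rV => // j; rewrite /lin.
    case: (split_ordP j) => j' ->.
      apply: (class_C_eq oU (f := fun=> p 0 j')) (class_C_cst _ _ _) => y _.
      by rewrite row_mxEl.
    apply: (class_C_eq oU (f := fun y => \sum_(i | iota i == tagnat.sig1 j')
      (Ug i).2 (submxrow y i) 0 (inord (tagnat.sig2 j')) : R^o)) => [y _|].
      by rewrite row_mxEr !mxE.
    apply: class_C_sum => // i _; apply: class_C_coord => //.
    apply: (class_C_subset (U' := (fun y => submxrow y i) @^-1` (Ug i).1)).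
      by move=> y; exact.
    apply: (class_C_comp_affine (L' := fun y => submxrow y i)) => //.
    * exact: submxrow_continuous.
    * by move=> *; exact: submxrow_affine.
    * by case: (HUg i).
  + move=> y Zy Uy; rewrite /lin; congr row_mx.
    apply/mxrowP => b; rewrite !mxrowK; apply/rowP => l; rewrite !mxE.
    by apply: eq_bigr => i _; case: (HUg i) => _ _ _ ->.
- move=> x [xp Xx x0]; have FX i := let: And4 _ _ FX _ := HG i in FX _ (Xx i).
  split=> [i|]; first by rewrite mxrowK; case: (FX i).
  rewrite -[RHS]hsubmxK xp; congr row_mx; apply/mxrowP => b; rewrite mxrowK.
  have [/codomP[i ->]|bi] := boolP (b \in codom iota).
    have := linE G (phi x) i; rewrite {1}/block /lin row_mxKr mxrowK => ->.
    by rewrite mxrowK (FX i).2.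
  rewrite -/(block b x) x0 //; apply/rowP => l; rewrite !mxE big_pred0 // => i.
  by apply: contraNF bi => /eqP <-; exact: codom_f.
- move=> z Zz; have GZ i := let: And4 _ _ _ GZ := HG i in GZ _ (Zz i).
  split; first split=> [|i|b bi].
  + by rewrite row_mxKl.
  + by rewrite linE; case: (GZ i).
  + rewrite /block row_mxKr mxrowK; apply/rowP => l; rewrite !mxE big_pred0 // => i.
    by apply: contraNF bi => /eqP <-; exact: codom_f.
  + by apply/mxrowP => i; rewrite mxrowK linE; case: (GZ i).
Qed.

Lemma smooth_submanifold_blocks p (X : forall i, set 'rV[R]_(mu (iota i)).+1) :
  (forall i, smooth_submanifold (d_ i) (X i)) ->
  smooth_submanifold (\sum_(i < r) d_ i) (block_product p X).
Proof.
move=> HX x [xp Xx x0].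
have HU i : exists UV : set 'rV[R]_(mu (iota i)).+1 * set 'rV[R]_(d_ i),
    [/\ open UV.1, UV.1 (block (iota i) x), open UV.2 &
      diffeomorphic (X i `&` UV.1) UV.2].
  by have [U [V UV]] := HX i _ (Xx i); exists (U, V).
have [UV HUV] := choice_dep HU.
exists [set y | forall i, (UV i).1 (block (iota i) y)], (row_product (fun i => (UV i).2)).
split.
- apply: (@open_forall _ _ (fun i => block (iota i) @^-1` (UV i).1)) => i.
  by apply: open_comp => [y _|]; [exact: block_continuous|case: (HUV i)].
- by move=> i; case: (HUV i).
- apply: (@open_forall _ _ (fun i => (fun y => submxrow y i) @^-1` (UV i).2)) => i.
  by apply: open_comp => [y _|]; [exact: submxrow_continuous|case: (HUV i)].
- rewrite (_ : _ `&` _ = block_product p (fun i => X i `&` (UV i).1)).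
    by apply: diffeomorphic_blocks => i; case: (HUV i).
  apply/seteqP; split=> y; first by move=> [[yp Xy y0] Uy]; split.
  by move=> [yp XUy y0]; split; [split=> // i; case: (XUy i)|move=> i; case: (XUy i)].
Qed.

End Blocks.

(** * Spheres of positive radius and their charts *)

Section Sphere.
Context {R : realType}.

(** The parameter [c] is the square of the radius, so that it can be the value of a polynomial. *)
Definition sphere (k : nat) (c : R) : set 'rV[R]_k.+1 := [set y | \sum_i y 0 i ^+ 2 = c].

Arguments sphere k c : clear implicits.

Lemma smooth_map_of_smooth_on a b (U X : set 'rV[R]_a) (f g : 'rV[R]_a -> 'rV[R]_b) :
  open U -> X `<=` U -> smooth_on U g -> (forall x, X x -> f x = g x) ->
  smooth_map X f.
Proof.
move=> oU XU gU fg x Xx; exists U, g; split=> // [|y Xy _]; first exact: XU.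
exact: fg.
Qed.

Lemma class_C_coordinate a k (U : set 'rV[R]_a) i :
  open U -> class_C k U (fun x : 'rV[R]_a => x 0 i : R^o).
Proof. by move=> oU; apply: class_C_coord => //; exact: class_C_id. Qed.

Lemma smooth_scale a (t : R) : smooth_on setT (fun x : 'rV[R]_a => t *: x).
Proof.
move=> k; apply: class_C_rV => [|i]; first exact: openT.
apply: (class_C_eq openT (f := fun x : 'rV[R]_a => t * x 0 i : R^o)) => [x _|]; first by rewrite mxE.
by apply: class_CM; [exact: openT|exact: class_C_cst|exact/class_C_coordinate/openT].
Qed.

Lemma diffeomorphic_sphere k (c : R) : 0 < c ->
  diffeomorphic (sphere k c) (@unit_sphere R k).
Proof.
move=> c0; have s0 : 0 < Num.sqrt c by rewrite sqrtr_gt0.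
have sc : Num.sqrt c ^+ 2 = c by rewrite sqr_sqrtr // ltW.
have smooth (t : R) X : smooth_map X (fun x : 'rV[R]_k.+1 => t *: x).
  by apply: (smooth_map_of_smooth_on openT _ (@smooth_scale _ t)).
have sphereZ t (y : 'rV[R]_k.+1) :
    \sum_i (t *: y) 0 i ^+ 2 = t ^+ 2 * \sum_i y 0 i ^+ 2.
  by rewrite mulr_sumr; apply: eq_bigr => i _; rewrite mxE exprMn.
exists (fun x => (Num.sqrt c)^-1 *: x), (fun y => Num.sqrt c *: y); split=> //.
- move=> x; rewrite /sphere /unit_sphere /= sphereZ => ->.
  by rewrite exprVn sc mulVf ?gt_eqF // scalerA divff ?gt_eqF // scale1r.
- move=> x; rewrite /sphere /unit_sphere /= sphereZ => ->.
  by rewrite sc mulr1 scalerA mulVf ?gt_eqF // scale1r.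
Qed.

(* Stereographic projection from a pole of the first axis. *)
Lemma smooth_submanifold_sphere k (c : R) : 0 < c ->
  smooth_submanifold k (sphere k c).
Proof.
move=> c0 x Sx; pose rho := Num.sqrt c.
have r0 : 0 < rho by rewrite sqrtr_gt0.
have rc : rho ^+ 2 = c by rewrite sqr_sqrtr // ltW.
(* The sign [s] selects the pole [s * rho] on the first axis, chosen away from [x]. *)
have [s [s2 xs]] : exists s, s ^+ 2 = 1 /\ s * x 0 0 != rho.
  have [x0|x0] := eqVneq (x 0 0) rho; last by exists 1; rewrite expr1n mul1r.
  by exists (- 1); rewrite sqrrN expr1n x0 mulN1r; split=> //; apply/eqP; lra.
pose U := [set y : 'rV[R]_k.+1 | rho - s * y 0 0 != 0].
have oU : open U.
  apply: (@open_comp _ _ (fun y : 'rV[R]_k.+1 => rho - s * y 0 0) [set t | t != 0]).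
    move=> y _; exact: (cvgB (@cst_continuous _ R rho y)
      (cvgM (@cst_continuous _ R s y) (@coord_continuous R 1 k.+1 0 0 y))).
  exact: open_neq.
pose q (z : 'rV[R]_k) := \sum_i z 0 i ^+ 2.
have q1 z : q z + 1 != 0.
  by rewrite gt_eqF // ltr_wpDl //; apply: sumr_ge0 => i _; exact: sqr_ge0.
(* [F] projects from the chosen pole, and [G] is its inverse, defined on all of R^k. *)
pose F (y : 'rV[R]_k.+1) : 'rV[R]_k := \row_l (y 0 (lift 0 l) * (rho - s * y 0 0)^-1).
pose G (z : 'rV[R]_k) : 'rV[R]_k.+1 :=
  \row_i if unlift 0 i is Some l then 2 * rho * z 0 l * (q z + 1)^-1
         else s * rho * (q z - 1) * (q z + 1)^-1.
have G0 z : G z 0 0 = s * rho * (q z - 1) * (q z + 1)^-1.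
  by rewrite mxE unlift_none.
have Gl z l : G z 0 (lift 0 l) = 2 * rho * z 0 l * (q z + 1)^-1.
  by rewrite mxE liftK.
have GU z : rho - s * G z 0 0 = 2 * rho * (q z + 1)^-1.
  rewrite G0; transitivity (rho - s ^+ 2 * rho * (q z - 1) * (q z + 1)^-1).
    by ring.
  by rewrite s2; field.
have FG z : F (G z) = z.
  apply/rowP => l; rewrite mxE GU Gl; field.
  by rewrite q1 gt_eqF.
have Fsmooth : smooth_on U F.
  move=> m; apply: class_C_rV => // l.
  apply: (class_C_eq oU (f := fun y : 'rV[R]_k.+1 => y 0 (lift 0 l) * (rho - s * y 0 0)^-1 : R^o)) => [y _|].
    by rewrite mxE.
  apply: class_CM => //; first exact: class_C_coordinate.
  apply: class_CV => //.
  apply: class_CD => //; first exact: class_C_cst.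
  apply: (class_C_eq oU (f := fun y : 'rV[R]_k.+1 => - s * y 0 0 : R^o)) => [y _|]; first by rewrite mulNr.
  by apply: class_CM => //; [exact: class_C_cst|exact: class_C_coordinate].
have Gsmooth : smooth_on setT G.
  move=> m; apply: class_C_rV => [|i]; first exact: openT.
  have Cq t : class_C m setT (fun z => q z + t : R^o).
    apply: class_CD; [exact: openT| |exact: class_C_cst].
    apply: class_C_sum => [|j _]; first exact: openT.
    by rewrite /=; apply: class_CM; exact: openT || exact/class_C_coordinate/openT.
  have CV : class_C m setT (fun z => (q z + 1)^-1 : R^o).
    by apply: class_CV => //; exact: openT.
  have Ccst (t : R) : class_C m setT (fun _ : 'rV[R]_k => t : R^o) by exact: class_C_cst.
  have oT : open [set: 'rV[R]_k] by exact: openT.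
  case: (unliftP 0 i) => [l ->|->].
    apply: (class_C_eq openT (f := fun z : 'rV[R]_k => 2 * rho * z 0 l * (q z + 1)^-1 : R^o)) => [z _|].
      by rewrite Gl.
    apply: class_CM => //; apply: class_CM => //; exact: class_C_coordinate.
  apply: (class_C_eq openT (f := fun z : 'rV[R]_k => s * rho * (q z - 1) * (q z + 1)^-1 : R^o)) => [z _|].
    by rewrite G0.
  by apply: class_CM => //; apply: class_CM.
exists U, setT; split=> //; first by rewrite /U /= subr_eq0 eq_sym.
  exact: openT.
exists F, G; split.
- by apply: (smooth_map_of_smooth_on oU _ Fsmooth) => // y [].
- exact: (smooth_map_of_smooth_on openT _ Gsmooth).
- move=> y [Sy Uy]; split=> //.
  (* On the sphere the other coordinates have square sum [rho ^+ 2 - y 0 0 ^+ 2], which factors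
     since [s ^+ 2 = 1]; one factor cancels against the denominator. *)
  have qF : q (F y) = (rho + s * y 0 0) / (rho - s * y 0 0).
    have : \sum_(l < k) y 0 (lift 0 l) ^+ 2 = (rho + s * y 0 0) * (rho - s * y 0 0).
      move: Sy; rewrite /sphere /= big_ord_recl -rc => Sy.
      transitivity (rho ^+ 2 - s ^+ 2 * y 0 0 ^+ 2); last by ring.
      by rewrite s2 mul1r -Sy addrC addKr.
    rewrite /q => E; under eq_bigr do rewrite mxE exprMn.
    by rewrite -mulr_suml E -mulrA expr2 mulrA mulrA mulrK ?unitfE.
  have qF1 : q (F y) + 1 = 2 * rho / (rho - s * y 0 0) by rewrite qF; field.
  apply/rowP => i; case: (unliftP 0 i) => [l ->|->].
    by rewrite Gl qF1 mxE; field; rewrite Uy gt_eqF.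
  rewrite G0 qF1 qF; transitivity (s ^+ 2 * y 0 0); last by rewrite s2 mul1r.
  by field; rewrite Uy gt_eqF.
- move=> z _; split=> //; split; last first.
    rewrite /U /= GU mulf_neq0 ?invr_eq0 ?q1 // mulf_neq0 ?pnatr_eq0 //.
    by rewrite gt_eqF.
  rewrite /sphere /= big_ord_recl G0.
  under eq_bigr do rewrite Gl.
  have -> : \sum_(i < k) (2 * rho * z 0 i / (q z + 1)) ^+ 2 =
      (2 * rho / (q z + 1)) ^+ 2 * q z.
    by rewrite mulr_sumr; apply: eq_bigr => i _; ring.
  transitivity (rho ^+ 2 * (s ^+ 2 * (q z - 1) ^+ 2 + 4 * q z) / (q z + 1) ^+ 2).
    by field; rewrite q1.
  by rewrite s2 -rc; field; rewrite q1.
Qed.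

End Sphere.

Arguments sphere {R} k c.

Lemma compact_continuous_bounded (R : realType) (T : topologicalType)
    (K : set T) (g : T -> R) :
  compact K -> continuous g -> exists C, forall x, K x -> `|g x| <= C.
Proof.
move=> cK cg; have : compact (g @` K).
  by apply: continuous_compact => //; exact: continuous_subspaceT.
move=> /(@compact_bounded R R^o)[C [_ HC]]; exists (C + 1) => x Kx.
by apply: (HC (C + 1)); [rewrite ltrDl|exists x].
Qed.

(** * Arcs of great circles from the north pole *)

Section Rotation.
Context {R : realType}.

Definition north k : 'rV[R]_k.+1 := delta_mx 0 0.

Lemma sumsq_axis k (a : R) (w : 'rV[R]_k.+1) (y : 'rV[R]_k.+1) :
  w 0 0 = 0 -> y = a *: north k + w ->
  \sum_i y 0 i ^+ 2 = a ^+ 2 + \sum_i w 0 i ^+ 2.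
Proof.
move=> w0 ->; rewrite !big_ord_recl /= w0 !mxE eqxx /= mulr1 w0 addr0 expr0n add0r.
by congr (_ + _); apply: eq_bigr => i _; rewrite !mxE /= mulr0 add0r.
Qed.

Lemma unit_north k : unit_sphere (north k).
Proof.
rewrite /unit_sphere /= (@sumsq_axis _ 1 0) ?mxE // ?scale1r ?addr0 //.
by rewrite expr1n big1 ?addr0 // => i _; rewrite mxE expr0n.
Qed.

(* A great circle through the north pole and [y]. *)
Lemma unit_sphere_path k (y : 'rV[R]_k.+1) : (0 < k)%N -> unit_sphere y ->
  exists g : R -> 'rV[R]_k.+1,
    [/\ continuous g, forall t, unit_sphere (g t), g 0 = north k & g 1 = y].
Proof.
case: k y => // k y _ Sy.
pose z : 'rV[R]_k.+2 := y - y 0 0 *: north k.+1.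
have z0 : z 0 0 = 0 by rewrite !mxE eqxx mulr1 subrr.
have yE : y = y 0 0 *: north k.+1 + z by rewrite addrC subrK.
have zz : \sum_i z 0 i ^+ 2 = 1 - y 0 0 ^+ 2.
  by rewrite -Sy (sumsq_axis z0 yE) addrC addKr.
have y1 : -1 <= y 0 0 <= 1.
  rewrite -ler_norml -(@ler_pXn2r _ 2) ?nnegrE // real_normK ?num_real // expr1n.
  by rewrite -subr_ge0 -zz; apply: sumr_ge0 => i _; exact: sqr_ge0.
have zz0 : 0 <= 1 - y 0 0 ^+ 2.
  by rewrite -zz; apply: sumr_ge0 => i _; exact: sqr_ge0.
(* A unit direction orthogonal to the axis. If [y] is a pole then [z = 0] and any such direction
   serves; the second axis is available because the sphere has positive dimension. *)
have [w [w0 ww zE]] : exists w : 'rV[R]_k.+2, [/\ w 0 0 = 0,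
    \sum_i w 0 i ^+ 2 = 1 & z = Num.sqrt (1 - y 0 0 ^+ 2) *: w].
  have [e|e] := eqVneq (1 - y 0 0 ^+ 2) 0.
    exists (delta_mx 0 (lift 0 0)); split; first by rewrite mxE.
      rewrite (bigD1 (lift 0 0)) //= mxE !eqxx expr1n big1 ?addr0 // => i /negPf i0.
      by rewrite mxE i0 andbF expr0n.
    rewrite e sqrtr0 scale0r; apply/rowP => i; rewrite [RHS]mxE.
    have := zz; rewrite e => /psumr_eq0P H; apply/eqP.
    by rewrite -sqrf_eq0 H // => j _; exact: sqr_ge0.
  have s0 : Num.sqrt (1 - y 0 0 ^+ 2) != 0.
    by rewrite gt_eqF // sqrtr_gt0 lt_neqAle eq_sym e.
  exists ((Num.sqrt (1 - y 0 0 ^+ 2))^-1 *: z); split.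
  - by rewrite mxE z0 mulr0.
  - under eq_bigr do rewrite mxE exprMn.
    by rewrite -mulr_sumr zz exprVn sqr_sqrtr // mulVf.
  - by rewrite scalerA divff // scale1r.
(* The angle runs from 0 to that of [y], which is [acos (y 0 0)]. *)
pose g (t : R) := cos (t * acos (y 0 0)) *: north k.+1 + sin (t * acos (y 0 0)) *: w.
exists g; split.
- have ct : continuous (fun t : R => t * acos (y 0 0)).
    by move=> t; exact: (cvgM cvg_id (@cst_continuous _ R _ t)).
  move=> t; apply: cvgD; apply: cvgZ; do ?exact: cvg_cst.
    exact: (continuous_comp (ct t) (@continuous_cos R _)).
  exact: (continuous_comp (ct t) (@continuous_sin R _)).
- move=> t; rewrite /unit_sphere /= (@sumsq_axis _ _ _ (g t) _ erefl).
    under eq_bigr do rewrite mxE exprMn.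
    by rewrite -mulr_sumr ww mulr1 cos2Dsin2.
  by rewrite mxE w0 mulr0.
- by rewrite /g !mul0r cos0 sin0 scale1r scale0r addr0.
- by rewrite /g !mul1r acosK ?in_itv // sin_acos // -zE -yE.
Qed.

End Rotation.

(** * The manifold over the closure of D *)

Section Region.
Context {R : realType} {l1 l2 n : nat}.
Variables (f_ : 'I_l1 -> mpoly.mpoly n R) (h : 'I_l1 -> 'I_l2).
Implicit Types (p x v : 'rV[R]_n).

Definition active p : {set 'I_l1} := [set j | peval (f_ j) p == 0]%SET.

Definition group_poly (b : 'I_l2) : mpoly.mpoly n R := \prod_(j | h j == b) f_ j.

(** Conditions (1) to (3) in pointwise form: [frame] provides vectors dual to the active gradients,
    and [h_inj] says that no P_b has two factors vanishing at [p]. *)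
Variables (D U0 : set 'rV[R]_n).
Hypotheses (U0_open : open U0) (clD_U0 : closure D `<=` U0)
  (DE : D = U0 `&` \bigcap_(j in [set: 'I_l1]) [set x | 0 < peval (f_ j) x])
  (frame : forall p, closure D p -> exists v : 'I_l1 -> 'rV[R]_n,
     {in active p &, forall j j',
       \sum_i v j 0 i * gradient (f_ j') p 0 i = (j' == j)%:R})
  (h_inj : forall p, closure D p -> {in active p &, injective h}).

Lemma closure_ge0 p j : closure D p -> 0 <= peval (f_ j) p.
Proof.
have : closed (peval (f_ j) @^-1` [set y : R | 0 <= y]).
  by apply: closed_comp => [x _|]; [exact: peval_continuous|exact: closed_ge].
move=> /closure_id => E; suff : closure D `<=` peval (f_ j) @^-1` [set y : R | 0 <= y].
  by apply.
rewrite E; apply: closureS; rewrite DE => x [_ /(_ j I)] /=.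
exact: ltW.
Qed.

Lemma group_poly_ge0 p b : closure D p -> 0 <= peval (group_poly b) p.
Proof.
by move=> Dp; rewrite peval_prod; apply: prodr_ge0 => j _; exact: closure_ge0.
Qed.

Lemma active_group p b : closure D p -> peval (group_poly b) p = 0 ->
  exists2 j, j \in active p & h j = b.
Proof.
move=> Dp /eqP; rewrite peval_prod => /prodf_eq0[j /eqP hj fj].
by exists j => //; rewrite inE.
Qed.

(* Moving along a vector on which the differentials of all active constraints
   are positive leads from [x] into D. *)
Lemma near_closure p : closure D p ->
  \forall x \near p, (forall b, 0 <= peval (group_poly b) x) -> closure D x.
Proof.
move=> Dp; have [v vE] := frame Dp.
(* The sum of the dual vectors pairs to 1 with every active gradient at once. *)
pose w := \sum_(j in active p) v j.
have wE j : j \in active p -> \sum_i w 0 i * gradient (f_ j) p 0 i = 1.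
  move=> jp; transitivity (\sum_(j' in active p) (j == j')%:R : R).
    rewrite /w; under eq_bigr do rewrite summxE mulr_suml.
    by rewrite exchange_big /=; apply: eq_bigr => j' j'p; rewrite vE.
  by rewrite (bigD1 j) //= eqxx big1 ?addr0 // => j' /andP[_ /negPf]; rewrite eq_sym => ->.
have [A HA] := choice (fun j => difference_quotient_exists (f_ j)).
pose y (z : 'rV[R]_n * R) : 'rV[R]_n := z.1 + z.2 *: w.
have cy : continuous y.
  by move=> z; apply: cvgD; [exact: cvg_fst|apply: cvgZ; [exact: cvg_snd|exact: cvg_cst]].
have y0 x : y (x, 0) = x by rewrite /y /= scale0r addr0.
(* For an active constraint, its quotient along [w] from [x] to [x + t w] is positive; an inactive
   one stays positive at both ends. *)
pose good z j := (if j \in active p then 0 < \sum_i w 0 i * A j i z.1 (y z)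
  else (0 < peval (f_ j) (y z)) && (0 < peval (f_ j) z.1)).
have near_good : \forall z \near ((p, 0) : 'rV[R]_n * R), forall j, good z j.
  suff H j : \forall z \near ((p, 0) : 'rV[R]_n * R), good z j.
    exact: (@filter_forall _ _ (fun j z => good z j) (nbhs (p, 0 : R)) _ H).
  rewrite /good; case jp: (j \in active p).
    have [cA _ dA] := HA j.
    suff H : \sum_i w 0 i * A j i z.1 (y z) @[z --> nbhs (p, 0 : R)] --> (1 : R).
      exact: (cvgr_gt _ H _ ltr01).
    rewrite -(wE _ jp); apply: (cvg_big add_continuous) => i _.
    apply: cvgM; first exact: cvg_cst.
    rewrite -dA -[X in A j i _ X](y0 p).
    have cz : continuous (fun z : 'rV[R]_n * R => (z.1, y z)).
      by apply: continuous_pair => // z; exact: cvg_fst.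
    exact: (continuous_comp (cz (p, 0)) (cA i _)).
  have fp : 0 < peval (f_ j) p.
    by rewrite lt_neqAle closure_ge0 // andbT eq_sym; rewrite inE in jp; rewrite jp.
  have H1 : peval (f_ j) (y z) @[z --> nbhs (p, 0 : R)] --> peval (f_ j) p.
    rewrite -{2}(y0 p).
    exact: (continuous_comp (cy (p, 0)) (@peval_continuous _ _ _ _)).
  have H2 : peval (f_ j) z.1 @[z --> nbhs (p, 0 : R)] --> peval (f_ j) p.
    apply: (@continuous_comp _ _ _ fst (peval (f_ j)) (p, 0 : R)).
      exact: cvg_fst.
    exact: peval_continuous.
  by apply: filterS2 (cvgr_gt _ H1 _ fp) (cvgr_gt _ H2 _ fp) => z ? ?; apply/andP.
have near_U0 : \forall z \near ((p, 0) : 'rV[R]_n * R), U0 (y z).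
  apply: (cy (p, 0)); rewrite y0; apply: open_nbhs_nbhs; split=> //.
  exact: clD_U0.
have : \forall z \near ((p, 0) : 'rV[R]_n * R), (forall j, good z j) /\ U0 (y z).
  exact: filterI near_good near_U0.
move=> /nbhs_ballP[e /= e0 He].
apply/nbhs_ballP; exists e => //= x px Px B Bx.
have yD t : 0 < t -> t < e -> D (y (x, t)).
  move=> t0 te; have [] : (forall j, good (x, t) j) /\ U0 (y (x, t)).
    by apply: He; split=> //=; rewrite /ball /= sub0r normrN gtr0_norm.
  move=> gxt Uy; rewrite DE; split=> // j _ /=.
  have := gxt j; rewrite /good; case: ifPn => [jp /= Aj|_ /andP[]//].
  (* By [h_inj] the other factors of the product containing [f_ j] are inactive at [p], hence
     positive at [x]; the sign of the product is therefore that of [f_ j]. *)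
  have fx : 0 <= peval (f_ j) x.
    have := Px (h j); rewrite peval_prod (bigD1 j) //= pmulr_lge0 //.
    apply: prodr_gt0 => j' /andP[/eqP hj' j'j].
    have := gxt j'; rewrite /good; case: ifPn => [j'p|_ /andP[]//].
    by move: (h_inj Dp j'p jp hj') j'j => ->; rewrite eqxx.
  have [_ /(_ x (y (x, t))) fE _] := HA j.
  rewrite -(subrK (peval (f_ j) x) (peval _ _)) fE ltr_pwDl //.
  rewrite (_ : \sum_i _ = t * \sum_i w 0 i * A j i x (y (x, t))) ?mulr_gt0 //.
  by rewrite mulr_sumr; apply: eq_bigr => i _; rewrite !mxE /=; ring.
(* The points [x + t w] lie in [D] for small positive [t] and tend to [x]. *)
have cyx : y (x, t) @[t --> (0 : R)] --> x.
  rewrite -[X in _ --> X]y0.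
  apply: (@continuous_comp _ _ _ (fun t : R => (x, t)) y 0); last exact: cy.
  exact: (cvg_pair (@cst_continuous _ _ x (0 : R)) cvg_id).
have [t [[t0 te] Bt]] : exists t, (0 < t /\ t < e) /\ B (y (x, t)).
  apply: (@filter_ex _ (0 : R)^'+); near=> t; split; first split; near: t.
  - exact: nbhs_right_gt.
  - exact: nbhs_right_lt.
  - exact: (cvg_at_right_filter cyx Bx).
by exists (y (x, t)); split=> //; exact: yD.
Unshelve. all: by end_near. Qed.

(** * Equations of the manifold, their differentials, and compactness *)

Variable mu : 'I_l2 -> nat.

Local Notation k := (\sum_(b < l2) (mu b).+1)%N.

Definition widen_poly (p : mpoly.mpoly n R) : mpoly.mpoly (n + k) R :=
  mpoly.comp_mpoly [tuple mpoly.mpolyX R (mpoly.mnm1 (lshift k i)) | i < n] p.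

Lemma peval_widen (p : mpoly.mpoly n R) (x : 'rV[R]_(n + k)) :
  peval (widen_poly p) x = peval p (lsubmx x).
Proof.
rewrite /peval /widen_poly mpoly.comp_mpoly_meval; apply: mpoly.meval_eq => i.
by rewrite tnth_mktuple mpoly.mevalXU mxE.
Qed.

Lemma widen_polyX i : widen_poly (mpoly.mpolyX R (mpoly.mnm1 i)) =
  mpoly.mpolyX R (mpoly.mnm1 (lshift k i)).
Proof. by rewrite /widen_poly mpoly.comp_mpolyXU -tnth_nth tnth_mktuple. Qed.

Lemma widen_polyC c : widen_poly (mpoly.mpolyC n c) = mpoly.mpolyC (n + k) c.
Proof. exact: mpoly.comp_mpolyC. Qed.

Lemma widen_polyD : {morph widen_poly : p q / p + q}.
Proof. exact: mpoly.comp_mpolyD. Qed.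

Lemma widen_polyM : {morph widen_poly : p q / p * q}.
Proof. by move=> p q; rewrite /widen_poly rmorphM. Qed.

Lemma mderiv_widen_lshift (p : mpoly.mpoly n R) i :
  mpoly.mderiv (lshift k i) (widen_poly p) = widen_poly (mpoly.mderiv i p).
Proof.
elim/mpoly_alg_ind: p => [c|j|p q IHp IHq|p q IHp IHq].
- by rewrite widen_polyC !mpoly.mderivC -(mpoly.mpolyC0 n) widen_polyC mpoly.mpolyC0.
- by rewrite widen_polyX !mderiv_var eq_lshift widen_polyC.
- by rewrite widen_polyD !mpoly.mderivD widen_polyD IHp IHq.
- by rewrite widen_polyM !mpoly.mderivM widen_polyD !widen_polyM IHp IHq.
Qed.

Lemma mderiv_widen_rshift (p : mpoly.mpoly n R) i :
  mpoly.mderiv (rshift n i) (widen_poly p) = 0.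
Proof.
elim/mpoly_alg_ind: p => [c|j|p q IHp IHq|p q IHp IHq].
- by rewrite widen_polyC mpoly.mderivC.
- by rewrite widen_polyX mderiv_var eq_sym eq_lrshift mpoly.mpolyC0.
- by rewrite widen_polyD mpoly.mderivD IHp IHq addr0.
- by rewrite widen_polyM mpoly.mderivM IHp IHq mul0r mulr0 addr0.
Qed.

Definition sphere_poly b : mpoly.mpoly (n + k) R :=
  \sum_(l < (mu b).+1) mpoly.mpolyX R (mpoly.mnm1 (rshift n (tagnat.Rank b l)))
                     * mpoly.mpolyX R (mpoly.mnm1 (rshift n (tagnat.Rank b l))).

Lemma peval_sphere_poly b (x : 'rV[R]_(n + k)) :
  peval (sphere_poly b) x = \sum_l block b x 0 l ^+ 2.
Proof.
rewrite peval_sum; apply: eq_bigr => l _.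
by rewrite pevalM pevalX !mxE expr2.
Qed.

Lemma mderiv_sphere_poly_lshift b i : mpoly.mderiv (lshift k i) (sphere_poly b) = 0.
Proof.
rewrite raddf_sum; apply: big1 => l _.
by rewrite /= mpoly.mderivM mderiv_var eq_lrshift mpoly.mpolyC0 mul0r mulr0 addr0.
Qed.

Lemma peval_mderiv_sphere_poly b b' (l : 'I_(mu b).+1) (x : 'rV[R]_(n + k)) :
  peval (mpoly.mderiv (rshift n (tagnat.Rank b l)) (sphere_poly b')) x =
  if b == b' then 2 * block b x 0 l else 0.
Proof.
rewrite raddf_sum peval_sum; case: eqVneq => [<-|bb'].
  rewrite (bigD1 l) //= mpoly.mderivM mderiv_var eqxx mpoly.mpolyC1 mul1r mulr1.
  rewrite pevalD !pevalX [X in _ + X]big1 => [|l' l'l].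
    by rewrite addr0 !mxE; ring.
  rewrite mpoly.mderivM mderiv_var eq_rshift -val_eqE tagnat.eq_Rank eqxx /=.
  by rewrite val_eqE eq_sym (negPf l'l) mpoly.mpolyC0 mul0r mulr0 addr0 /peval mpoly.meval0.
apply: big1 => l' _ /=.
rewrite mpoly.mderivM mderiv_var eq_rshift -val_eqE tagnat.eq_Rank (negPf bb') /=.
by rewrite mpoly.mpolyC0 mul0r mulr0 addr0 /peval mpoly.meval0.
Qed.

Definition bundle_poly b : mpoly.mpoly (n + k) R :=
  widen_poly (group_poly b) - sphere_poly b.

(* Where P_b vanishes, the sphere in the block b is a point. *)
Definition bundle : set 'rV[R]_(n + k) :=
  [set x | closure D (lsubmx x) /\
    forall b, sphere (mu b) (peval (group_poly b) (lsubmx x)) (block b x)].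

Lemma zero_set_bundle_poly b (x : 'rV[R]_(n + k)) : zero_set (bundle_poly b) x <->
  sphere (mu b) (peval (group_poly b) (lsubmx x)) (block b x).
Proof.
rewrite /zero_set /sphere /= pevalB peval_widen peval_sphere_poly.
by split=> [/eqP|->]; rewrite ?subrr // subr_eq0 => /eqP.
Qed.

Lemma lsubmx_continuous : continuous (@lsubmx R 1 n k).
Proof.
apply: continuous_rV => i; rewrite (_ : (fun y => _) =
  fun x : 'rV[R]_(n + k) => x 0 (lshift k i)); first exact: coord_continuous.
by apply/funext => x; rewrite mxE.
Qed.

Lemma bundle_setI :
  bundle = common_zero_set bundle_poly `&` @lsubmx R 1 n k @^-1` closure D.
Proof.
apply/seteqP; split=> x.
  by move=> [Dx Zx]; split=> // b; exact/zero_set_bundle_poly.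
by move=> [Zx Dx]; split=> // b; exact/zero_set_bundle_poly.
Qed.

Lemma closed_preimage_closure : closed (@lsubmx R 1 n k @^-1` closure D).
Proof.
by apply: closed_comp => [x _|]; [exact: lsubmx_continuous|exact: closed_closure].
Qed.

(** On the zero set each P_b equals a sum of squares and is nonnegative, so by [near_closure] the
    bundle is open there; it is also closed, as the part lying over the closure of D. A component
    that meets it is thus contained in it. *)
Lemma bundle_components : union_of_components (common_zero_set bundle_poly) bundle.
Proof.
pose W := [set x | (forall b, 0 <= peval (group_poly b) x) -> closure D x]°.
pose O := @lsubmx R 1 n k @^-1` W.
have oO : open O.
  by apply: open_comp => [x _|]; [exact: lsubmx_continuous|exact: open_interior].
have bundleE : common_zero_set bundle_poly `&` O = bundle.
  apply/seteqP; split=> x.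
    move=> [Zx /interior_subset Ox]; split; last by move=> b; exact/zero_set_bundle_poly.
    apply: Ox => b; have /zero_set_bundle_poly := Zx b.
    by rewrite /sphere /= => <-; apply: sumr_ge0 => l _; exact: sqr_ge0.
  move=> [Dx Zx]; split; last exact: near_closure.
  by move=> b; exact/zero_set_bundle_poly.
exists bundle; first by rewrite -bundleE; exact: subIsetl.
apply/seteqP; split=> x.
  move=> Mx; exists x => //; apply: connected_component_refl.
  by move: Mx; rewrite -bundleE => -[].
move=> [y My [C [Cy CZ cC] Cx]].
(* The intersection is nonempty, open and closed in the connected set [C]. *)
have CE : C `&` bundle = C.
  apply: cC; first by exists y.
    by exists O => //; rewrite -bundleE setIA (setIidl CZ).
  exists (@lsubmx R 1 n k @^-1` closure D); first exact: closed_preimage_closure.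
  by rewrite bundle_setI setIA (setIidl CZ).
by move: Cx; rewrite -CE => -[].
Qed.

(** In the Leibniz rule only the term differentiating [f_ j] survives. Its coefficient is the
    product of the other factors, none of which vanishes at [p] by [h_inj]. *)
Lemma gradient_group p j : closure D p -> j \in active p ->
  exists2 c : R, 0 < c &
    forall i, gradient (group_poly (h j)) p 0 i = c * gradient (f_ j) p 0 i.
Proof.
move=> Dp jp; exists (\prod_(j' | (h j' == h j) && (j' != j)) peval (f_ j') p).
  apply: prodr_gt0 => j' /andP[/eqP hj' j'j].
  rewrite lt_neqAle closure_ge0 // andbT eq_sym.
  apply: contraNN j'j => fj'; apply/eqP; apply: (h_inj Dp) => //.
  by rewrite inE.
move=> i; rewrite !mxE /group_poly (bigD1 j) //= mpoly.mderivM pevalD !pevalM.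
move: jp; rewrite inE => /eqP ->; rewrite mul0r addr0 mulrC; congr (_ * _).
exact: peval_prod.
Qed.

(** Let [u] be a relation among the rows. The columns in y give [u_b y_b = 0], so a nonzero [u_b]
    forces [y_b = 0], hence P_b = 0 and an active [f_ j] with [h j = b]. The columns in x then
    relate active gradients, and pairing with the dual frame excludes this. *)
Lemma bundle_row_free (x : 'rV[R]_(n + k)) :
  bundle x -> row_free (jacobian_mx bundle_poly x).
Proof.
move=> [Dx Sx]; apply: inj_row_free => u uJ.
set p := lsubmx x in Dx Sx.
have Jl i : \sum_b u 0 b * gradient (group_poly b) p 0 i = 0.
  have /rowP/(_ (lshift k i)) := uJ; rewrite !mxE; apply: etrans.
  apply: eq_bigr => b _; rewrite !mxE /bundle_poly mpoly.mderivB.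
  by rewrite mderiv_widen_lshift mderiv_sphere_poly_lshift subr0 peval_widen.
have Jr b l : u 0 b * block b x 0 l = 0.
  have JE b' : jacobian_mx bundle_poly x b' (rshift n (tagnat.Rank b l)) =
      if b == b' then - (2 * block b x 0 l) else 0.
    rewrite 2!mxE /bundle_poly mpoly.mderivB mderiv_widen_rshift sub0r.
    rewrite /peval mpoly.mevalN -/(peval _ _) peval_mderiv_sphere_poly.
    by case: eqP; rewrite ?oppr0.
  have /rowP/(_ (rshift n (tagnat.Rank b l))) := uJ; rewrite mxE [RHS]mxE.
  rewrite (bigD1 b) //= [X in _ + X]big1 => [|b' b'b]; last first.
    by rewrite JE eq_sym (negPf b'b) mulr0.
  rewrite JE eqxx addr0 => /eqP.
  by rewrite mulrN oppr_eq0 mulrCA mulf_eq0 pnatr_eq0 => /eqP.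
have act b : u 0 b != 0 -> exists2 j, j \in active p & h j = b.
  move=> ub; apply: active_group => //; rewrite -(Sx b) big1 // => l _.
  have /eqP := Jr b l; rewrite mulf_eq0 (negPf ub) /= => /eqP ->.
  by rewrite expr0n.
apply/rowP => b; rewrite [RHS]mxE; apply/eqP; apply/negP => /negP ub.
have [j jp hj] := act b ub; have [v vE] := frame Dx.
have := gradient_group Dx jp; rewrite hj => -[c c0 cE].
have : \sum_i v j 0 i * (\sum_b u 0 b * gradient (group_poly b) p 0 i) = 0.
  by rewrite big1 // => i _; rewrite Jl mulr0.
under eq_bigr do rewrite mulr_sumr.
rewrite exchange_big /= (bigD1 b) //= [X in _ + X]big1 => [|b' b'b].
  under eq_bigr do rewrite cE mulrCA [v _ _ _ * _]mulrCA mulrA.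
  rewrite -mulr_sumr vE // eqxx mulr1 addr0 => /eqP.
  by rewrite mulf_eq0 (negPf ub) gt_eqF.
(* Another group with nonzero coefficient has an active index different from [j], since [h]
   separates them, so its gradient pairs to 0 with [v j]. *)
have [->|ub'] := eqVneq (u 0 b') 0; first by rewrite big1 // => i _; rewrite mul0r mulr0.
have [j' j'p hj'] := act b' ub'.
have := gradient_group Dx j'p; rewrite hj' => -[c' _ cE'].
under eq_bigr do rewrite cE' mulrCA [v _ _ _ * _]mulrCA mulrA.
rewrite -mulr_sumr vE // [_ == _](negbTE _) ?mulr0 //.
by apply: contraNneq b'b => jj'; rewrite -hj -hj' jj'.
Qed.

Lemma bundle_compact : compact (closure D) -> compact bundle.
Proof.
move=> cD.
have bd1 (i : 'I_n) : exists c : R, forall p, closure D p -> `|p 0 i| <= c.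
  exact: compact_continuous_bounded cD (@coord_continuous R 1 n 0 i).
have bd2 (b : 'I_l2) : exists c : R, forall p, closure D p ->
    `|peval (group_poly b) p| <= c.
  exact: compact_continuous_bounded cD (@peval_continuous R n (group_poly b)).
have [C1 HC1] := choice bd1; have [C2 HC2] := choice bd2.
(* For a coordinate t of y_b one has t^2 <= P_b <= C2, and |t| <= 1 + t^2 gives a bound without
   square roots. *)
pose C (i : 'I_(n + k)) : R :=
  match fintype.split i with inl i' => C1 i' | inr j => 1 + C2 (tagnat.sig1 j) end.
have cbox : compact [set x : 'rV[R]_(n + k) | forall i, `[- C i, C i]%classic (x ord0 i)].
  by apply: (@rV_compact _ _ (fun i => `[- C i, C i]%classic)) => i; exact: segment_compact.
apply: subclosed_compact cbox _ => [|x [Dx Sx] i /=].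
  rewrite bundle_setI; apply: closedI; last exact: closed_preimage_closure.
  rewrite (_ : common_zero_set _ =
    \bigcap_(b in [set: 'I_l2]) peval (bundle_poly b) @^-1` [set 0]); last first.
    by apply/seteqP; split=> [y Hy b _|y Hy b]; [exact: Hy|exact: (Hy b I)].
  apply: closed_bigI => b _; apply: closed_comp => [y _|]; last exact: closed_eq.
  exact: peval_continuous.
rewrite in_itv /= -ler_norml /C; case: (split_ordP i) => [i' ->|j ->].
  by have := HC1 i' _ Dx; rewrite mxE.
set b := tagnat.sig1 j; have := HC2 b _ Dx; rewrite -(Sx b) => xC.
have le : x 0 (rshift n j) ^+ 2 <= C2 b.
  apply: le_trans xC; apply: le_trans (ler_norm _).
  rewrite (bigD1 (tagnat.sig2 j)) //= !mxE tagnat.sig2K lerDl.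
  by apply: sumr_ge0 => l _; exact: sqr_ge0.
rewrite -(@real_normK _ (x 0 _)) ?num_real // in le.
by have := sqr_ge0 (`|x 0 (rshift n j)| - 1); nra.
Qed.

(** * Sections, fibres and connectedness *)

(** Polar coordinates on the fibre: [w] holds the directions and the radii are the square roots of
    the P_b. A fixed family of unit directions gives a continuous section over the closure of D. *)
Definition bundle_point p (w : forall b, 'rV[R]_(mu b).+1) : 'rV[R]_(n + k) :=
  row_mx p (\mxrow_b (Num.sqrt (peval (group_poly b) p) *: w b)).

Lemma block_bundle_point p w b :
  block b (bundle_point p w) = Num.sqrt (peval (group_poly b) p) *: w b.
Proof. by rewrite /block row_mxKr mxrowK. Qed.

Lemma bundle_pointP p w : closure D p -> (forall b, unit_sphere (w b)) ->
  bundle (bundle_point p w).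
Proof.
move=> Dp Sw; split=> [|b]; rewrite row_mxKl // /sphere /= block_bundle_point.
under eq_bigr do rewrite mxE exprMn.
by rewrite -mulr_sumr (Sw b) mulr1 sqr_sqrtr // group_poly_ge0.
Qed.

Lemma sphere0 m (y : 'rV[R]_m.+1) : sphere m 0 y -> y = 0.
Proof.
move=> /psumr_eq0P y0; apply/rowP => l; apply/eqP; rewrite mxE -sqrf_eq0.
by rewrite y0 // => i _; exact: sqr_ge0.
Qed.

Lemma bundle_point_surj (x : 'rV[R]_(n + k)) : bundle x ->
  exists w, (forall b, unit_sphere (w b)) /\ x = bundle_point (lsubmx x) w.
Proof.
move=> [Dx Sx]; set p := lsubmx x in Dx Sx *.
have Hw b : exists w : 'rV[R]_(mu b).+1, unit_sphere w /\
    block b x = Num.sqrt (peval (group_poly b) p) *: w.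
  have P0 := group_poly_ge0 b Dx.
  (* At radius 0 the direction is arbitrary, and the pole is taken. *)
  have [e|e] := eqVneq (peval (group_poly b) p) 0.
    exists (north _); split; first exact: unit_north.
    by have := Sx b; rewrite e sqrtr0 scale0r; exact: sphere0.
  have s0 : Num.sqrt (peval (group_poly b) p) != 0.
    by rewrite gt_eqF // sqrtr_gt0 lt_neqAle eq_sym e.
  exists ((Num.sqrt (peval (group_poly b) p))^-1 *: block b x); split.
    rewrite /unit_sphere /=; under eq_bigr do rewrite mxE exprMn.
    by rewrite -mulr_sumr (Sx b) exprVn sqr_sqrtr // mulVf.
  by rewrite scalerA divff // scale1r.
have [w Ew] := choice_dep Hw; exists w; split=> [b|]; first by case: (Ew b).
rewrite -[LHS]hsubmxK; congr row_mx; apply/mxrowP => b; rewrite mxrowK.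
by case: (Ew b).
Qed.

Lemma bundle_image : @lsubmx R 1 n k @` bundle = closure D.
Proof.
apply/seteqP; split=> [_ [x [Dx _] <-] //|p Dp].
exists (bundle_point p (fun b => north (mu b))); last by rewrite row_mxKl.
by apply: bundle_pointP => // b; exact: unit_north.
Qed.

(** The blocks in [A] are those of positive radius; every other block satisfies the equation of a
    sphere of radius 0 and is the origin. *)
Lemma bundle_fiber p (A := [set b | 0 < peval (group_poly b) p]%SET) : closure D p ->
  bundle `&` @lsubmx R 1 n k @^-1` [set p] =
  block_product (iota := fun i : 'I_#|A| => enum_val i) p
    (fun i => sphere (mu (enum_val i)) (peval (group_poly (enum_val i)) p)).
Proof.
move=> Dp; apply/seteqP; split=> x.
  move=> [[Dx Sx] xp]; rewrite /= in xp; rewrite xp in Sx.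
  split=> // b bA; have := Sx b.
  have -> : peval (group_poly b) p = 0; last exact: sphere0.
  apply/eqP; rewrite eq_le group_poly_ge0 // andbT leNgt.
  apply: contraNN bA => Pb; apply/codomP.
  have bA : b \in A by rewrite inE.
  by exists (enum_rank_in bA b); rewrite enum_rankK_in.
move=> [xp Sx x0]; split=> //; split; rewrite xp // => b.
have [/codomP[i ->]|bA] := boolP (b \in codom (fun i : 'I_#|A| => enum_val i)).
  exact: Sx.
rewrite x0 // (_ : peval (group_poly b) p = 0).
  by rewrite /sphere /= big1 // => l _; rewrite mxE expr0n.
apply/eqP; rewrite eq_le group_poly_ge0 // andbT leNgt.
apply: contraNN bA => Pb; apply/codomP.
have bA : b \in A by rewrite inE.
by exists (enum_rank_in bA b); rewrite enum_rankK_in.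
Qed.

Lemma bundle_point_continuous (T : topologicalType) (g : T -> 'rV[R]_n)
    (w : T -> forall b, 'rV[R]_(mu b).+1) :
  continuous g -> (forall b, continuous (fun t => w t b)) ->
  continuous (fun t => bundle_point (g t) (w t)).
Proof.
move=> cg cw t; apply: cvg_rV => i; rewrite /bundle_point.
case: (split_ordP i) => [i' ->|j ->].
  rewrite row_mxEl (_ : (fun u => _) = fun t => g t 0 i').
    exact: (cvg_comp _ _ (cg t) (@coord_continuous R 1 n 0 i' _)).
  by apply/funext => u; rewrite row_mxEl.
set b := tagnat.sig1 j.
rewrite row_mxEr 2!mxE (_ : (fun u => _) = fun t =>
  Num.sqrt (peval (group_poly b) (g t)) * w t b 0 (tagnat.sig2 j)).
  apply: cvgM.
    have cP := continuous_comp (cg t) (@peval_continuous R n (group_poly b) _).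
    exact: (continuous_comp cP (@sqrt_continuous R _)).
  exact: (cvg_comp _ _ (cw b t) (@coord_continuous R 1 _ 0 _ _)).
by apply/funext => u; rewrite row_mxEr !mxE.
Qed.

(** The bundle is the union, over its points [x], of the image of the section through the poles with
    an arc from that image to [x]. Each such set is connected, and all contain the section's value
    at [p0]. *)
Lemma bundle_connected : closure D !=set0 -> connected (closure D) ->
  (forall b, (0 < mu b)%N) -> connected bundle.
Proof.
move=> [p0 Dp0] cD mu0.
have Hg (x : 'rV[R]_(n + k)) : exists g : R -> 'rV[R]_(n + k), bundle x ->
    [/\ continuous g, forall t, bundle (g t),
      g 0 = bundle_point (lsubmx x) (fun b => north (mu b)) & g 1 = x].
  have [Mx|] := pselect (bundle x); last by exists (fun=> 0).
  have [w [Sw xE]] := bundle_point_surj Mx.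
  have [g Hg] := choice_dep (fun b => unit_sphere_path (mu0 b) (Sw b)).
  exists (fun t => bundle_point (lsubmx x) (fun b => g b t)) => _; split.
  - apply: bundle_point_continuous => [t|b]; first exact: cvg_cst.
    by case: (Hg b).
  - by move=> t; apply: bundle_pointP => [|b]; [case: Mx|case: (Hg b)].
  - by congr bundle_point; apply: functional_extensionality_dep => b; case: (Hg b).
  - rewrite [RHS]xE; congr bundle_point.
    by apply: functional_extensionality_dep => b; case: (Hg b).
have [g gE] := choice Hg.
pose s p := bundle_point p (fun b => north (mu b)).
have cs : connected (s @` closure D).
  apply: connected_continuous_connected => //; apply: continuous_subspaceT.
  by apply: bundle_point_continuous => [p|b]; [exact: cvg_id|exact: cst_continuous].
have -> : bundle = \bigcup_(x in bundle) (s @` closure D `|` g x @` `[0, 1]).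
  apply/seteqP; split=> x.
    move=> Mx; exists x => //; right; exists 1; first by rewrite /= in_itv /= ler01 lexx.
    by case: (gE x Mx).
  move=> [y My [[p Dp <-]|[t _ <-]]]; last by case: (gE y My).
  by apply: bundle_pointP => // b; exact: unit_north.
apply: bigcup_connected; first by exists (s p0) => x _; left; exists p0.
move=> x Mx; have [cg _ g0 _] := gE x Mx; apply: connectedU => //.
  exists (g x 0); split; last by exists 0; rewrite //= in_itv /= lexx ler01.
  by rewrite g0; exists (lsubmx x) => //; case: Mx.
apply: connected_continuous_connected; first exact: segment_connected.
exact: continuous_subspaceT.
Qed.

End Region.

(** * The manifold and its projection from conditions (1) to (3) *)

Theorem theorem1 (R : realType) (l1 l2 n : nat)
  (l1_gt0 : (0 < l1)%N) (l2_gt0 : (0 < l2)%N) (n_gt0 : (0 < n)%N)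
  (f_ : 'I_l1 -> mpoly.mpoly n R) (S_ : 'I_l1 -> set 'rV[R]_n)
  (S_def : forall j, S_ j = zero_set (f_ j))
  (S_connected : forall j, connected (S_ j))
  (S_nonsingular : forall j, nonsingular_hypersurface (f_ j))
  (D : set 'rV[R]_n)
  (D_neq0 : D !=set0) (D_connected : connected D) (D_open : open D)
  (clD_compact : compact (closure D)) (clD_connected : connected (closure D))
  (cond1 : exists U0 : set 'rV[R]_n,
     [/\ open U0, closure D `<=` U0 &
       forall U : set 'rV[R]_n, open U -> closure D `<=` U -> U `<=` U0 ->
         D = U `&` \bigcap_(j in [set: 'I_l1]) [set x | 0 < peval (f_ j) x]])
  (cond2 : forall (l3 : nat) (j_ : 'I_l3 -> 'I_l1),
     (0 < l3 <= l1)%N -> (forall a b : 'I_l3, (a < b)%N -> (j_ a < j_ b)%N) ->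
     forall p, (\bigcap_(i in [set: 'I_l3]) S_ (j_ i) `&` closure D) p ->
     exists2 d : nat,
       has_dim (\bigcap_(i in [set: 'I_l3]) tangent_space (S_ (j_ i)) p) d &
       (d + l3 = n)%N)
  (cond3 : exists2 h : 'I_l1 -> 'I_l2,
     (forall b, exists a, h a = b) &
     forall (l3 : nat) (j_ : 'I_l3 -> 'I_l1),
       (0 < l3 <= l1)%N -> (forall a b : 'I_l3, (a < b)%N -> (j_ a < j_ b)%N) ->
       (\bigcap_(i in [set: 'I_l3]) S_ (j_ i) `&` closure D) !=set0 ->
       {in codom j_ &, injective h})
  (mu : 'I_l2 -> nat) (m : nat) (m_def : m = (n + \sum_(j < l2) mu j)%N) :
  exists (k : nat) (M : set 'rV[R]_(n + k)) (f : 'rV[R]_(n + k) -> 'rV[R]_n),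
    [/\ nonsingular_algebraic_manifold m M /\ compact M,
        real_algebraic_map M f /\ smooth_map M f,
        f @` M = closure D,
        forall p, closure D p ->
          ((exists x, M `&` f @^-1` [set p] = [set x]) \/
           (exists (r : nat) (e : 'I_r -> nat),
              diffeomorphic (M `&` f @^-1` [set p]) (@sphere_product R r e))) /\
          (exists2 d : nat,
             smooth_submanifold d (M `&` f @^-1` [set p]) & (d <= m - n)%N) &
        (forall j, (0 < mu j)%N) -> connected M].
Proof.
have {}S_def : S_ = fun j => zero_set (f_ j) by apply/funext.
subst S_.
have [U0 [U0_open clD_U0 /(_ U0 U0_open clD_U0 (@subset_refl _ U0)) DE]] := cond1.
have [h _ h_inj] := cond3.
(* The active indices at [p], listed increasingly, form a sequence to which conditions (2) and (3)
   apply, provided there is at least one. *)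
have active_seq (p : 'rV[R]_n) : closure D p -> active f_ p != finset.set0 ->
    (0 < #|active f_ p| <= l1)%N /\
    (\bigcap_(i in [set: 'I_#|active f_ p|]) zero_set (f_ (enum_val i)) `&` closure D) p.
  move=> Dp A0; split; first by rewrite card_gt0 A0 -[X in (_ <= X)%N]card_ord max_card.
  by split=> // i _; have := enum_valP i; rewrite inE => /eqP.
have frame (p : 'rV[R]_n) : closure D p -> exists v : 'I_l1 -> 'rV[R]_n,
    {in active f_ p &, forall j j',
      \sum_i v j 0 i * gradient (f_ j') p 0 i = (j' == j)%:R}.
  move=> Dp; have [A0|A0] := eqVneq (active f_ p) finset.set0.
    by exists (fun=> 0) => j j'; rewrite A0 inE.
  have [cardA Sp] := active_seq p Dp A0.
  have [d dimT dE] := cond2 _ _ cardA (@enum_val_ltn _ (active f_ p)) p Sp.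
  apply: (dual_frame _ _ dimT dE) => j; rewrite inE => /eqP // fj.
  exact: S_nonsingular.
have active_inj (p : 'rV[R]_n) : closure D p -> {in active f_ p &, injective h}.
  move=> Dp j j' jp j'p; have A0 : active f_ p != finset.set0.
    by apply/finset.set0Pn; exists j.
  have [cardA Sp] := active_seq p Dp A0.
  apply: (h_inj _ _ cardA (@enum_val_ltn _ (active f_ p)) (ex_intro _ p Sp)).
    by apply/codomP; exists (enum_rank_in jp j); rewrite enum_rankK_in.
  by apply/codomP; exists (enum_rank_in j'p j'); rewrite enum_rankK_in.
exists (\sum_(b < l2) (mu b).+1)%N, (bundle f_ h D (mu := mu)), (@lsubmx R 1 n _); split.
- split; last exact: (bundle_compact clD_compact).
  exists l2, (bundle_poly f_ h mu); split.
  (* Each of the [l2] equations removes the extra coordinate of one block. *)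
  + rewrite m_def -addnA; congr addn; under [RHS]eq_bigr do rewrite -addn1.
    by rewrite big_split /= sum_nat_const card_ord muln1.
  + exact: (bundle_components U0_open clD_U0 DE frame active_inj).
  + exact: (bundle_row_free DE frame active_inj).
- split=> //; apply: (smooth_map_of_smooth_on openT (g := @lsubmx R 1 n _)) => // c.
  apply: class_C_rV => [|i]; first exact: openT.
  apply: (class_C_eq openT _ (class_C_coordinate c (lshift _ i) openT)) => x _.
  by rewrite mxE.
- exact: (bundle_image h DE mu).
- move=> p Dp; have := bundle_fiber h DE mu Dp.
  set A := [set b | 0 < peval (group_poly f_ h b) p]%SET => /= ->.
  have PA (i : 'I_#|A|) : 0 < peval (group_poly f_ h (enum_val i)) p.
    by have := enum_valP i; rewrite inE.
  split.
    (* If [A] is empty, the product of no spheres is a point, so the second alternative covers every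
       fibre. *)
    right; exists #|A|, (fun i : 'I_#|A| => mu (enum_val i)).
    exact: (diffeomorphic_blocks (@enum_val_inj _ A) p
      (fun i => diffeomorphic_sphere (mu (enum_val i)) (PA i))).
  exists (\sum_(i < #|A|) mu (enum_val i))%N.
    exact: (smooth_submanifold_blocks (@enum_val_inj _ A)
      (fun i => smooth_submanifold_sphere (PA i))).
  (* The fibre dimension sums [mu] over [A] only, while [m - n] sums it over all groups. *)
  rewrite m_def addKn -[leqLHS](big_enum_val (A := mem A) mu) [leqRHS](bigID (mem A)) /=.
  exact: leq_addr.
- apply: (bundle_connected DE) => //.
  by case: D_neq0 => x /subset_closure Dx; exists x.
Qed.
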